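(* Let $\beta>0$ and $f_{\pm}(x)=\dfrac{1}{e^{\beta x}\pm1}$, and let $T_{f_\pm}$ be the tempered distributions generated by $f_\pm$ (via Hadamard finite part at $x=0$ where needed), whose Fourier transforms are $$\mathscr{F}T_{f_{\pm}}[\varphi]=\mathrm{f.p.\ of}\lim_{\epsilon\to0^{+}}\int_{|x|>\epsilon}\frac{\hat{\varphi}(x)}{e^{\beta x}\pm1}\,dx .$$ Then $$\mathscr{F}T_{f_{+}}=\pi\delta+T_{g},\qquad \mathscr{F}T_{f_{-}}=-\pi\delta+T_{h},$$ where $$g(x)=\frac{i\pi}{\beta\sinh\frac{\pi x}{\beta}},\qquad h(x)=\frac{\pi}{i\beta}\coth\frac{\pi x }{\beta},$$ and $T_g,T_h$ denote the distributions generated by $g,h$ (with the singularity at $x=0$ taken in the principal value / finite part sense).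
   Context: Fourier transform convention: $\hat{\varphi}(k)=\int_{\mathbb{R}}\varphi(x)e^{-ikx}\,dx$ for Schwartz functions $\varphi$, and $\mathscr{F}T[\varphi]:=T[\hat\varphi]$ for tempered distributions $T$. $\delta[\varphi]=\varphi(0)$. ''f.p. of'' (Hadamard finite part) means the constant term remaining after discarding the terms that diverge as $\epsilon\to0^+$. *)

(* Defs.v *)
From Stdlib Require Import Reals.
From Coquelicot Require Import Coquelicot.
Open Scope R_scope.

Definition schwartz_R (u : R -> R) : Prop :=
  (forall (n : nat) (x : R), ex_derive_n u n x) /\
  (forall k n : nat, exists M : R, forall x : R, Rabs (x ^ k * Derive_n u n x) <= M).

Definition schwartz (phi : R -> C) : Prop :=
  schwartz_R (fun x => Re (phi x)) /\ schwartz_R (fun x => Im (phi x)).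

Definition cis (t : R) : C := (cos t, sin t).

Definition is_fourier (phi psi : R -> C) : Prop :=
  forall k : R,
    is_RInt_gen (fun x => Cmult (phi x) (cis (- (k * x))))
      (Rbar_locally m_infty) (Rbar_locally p_infty) (psi k).

Definition is_trunc_int (F : R -> C) (eps : R) (v : C) : Prop :=
  exists v1 v2 : C,
    is_RInt_gen F (Rbar_locally m_infty) (at_point (- eps)) v1 /\
    is_RInt_gen F (at_point eps) (Rbar_locally p_infty) v2 /\
    v = Cplus v1 v2.

(** Hadamard finite part: c is the f.p. of I(eps) as eps -> 0+, i.e. after
    discarding divergent terms a_1 eps^-1 + ... + a_{n+1} eps^-(n+1) + b ln eps
    the remainder tends to c. *)
Definition is_fp (I : R -> C) (c : C) : Prop :=
  exists (n : nat) (a : nat -> C) (b : C),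
    filterlim
      (fun eps => Cminus (Cminus (I eps)
                   (sum_n (fun j => Cmult (a j) (RtoC (/ eps ^ (S j)))) n))
                   (Cmult b (RtoC (ln eps))))
      (at_right 0) (locally c).

Definition fp_int (F : R -> C) (c : C) : Prop :=
  exists I : R -> C,
    (forall eps : R, 0 < eps -> is_trunc_int F eps (I eps)) /\ is_fp I c.

Definition f_plus (beta x : R) : C := RtoC (/ (exp (beta * x) + 1)).
Definition f_minus (beta x : R) : C := RtoC (/ (exp (beta * x) - 1)).

Definition g_fun (beta x : R) : C := (0, PI / (beta * sinh (PI * x / beta))).
(** h(x) = pi/(i beta) coth(pi x / beta) = - i (pi/beta) coth(pi x / beta) *)
Definition h_fun (beta x : R) : C :=
  (0, - (PI / beta) * (cosh (PI * x / beta) / sinh (PI * x / beta))).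

(* Main.v *)
Require Import Defs.
From Stdlib Require Import Reals Lra Lia FunctionalExtensionality.
From Coquelicot Require Import Coquelicot.
Open Scope R_scope.

(* Write phi = u + i v and split u, v into even and odd parts. Pairing k with -k,
   the even parts contribute [+-PI * phi 0] by Fourier inversion, and the odd parts
   reduce both claims to half-line identities for the sine transform S of an odd
   Schwartz function w:
     int_0^oo S(k) coth(beta k / 2) dk = int_0^oo w(x) (PI / beta) coth(PI x / beta) dx,
   and the same with tanh and 1 / sinh, which follows from
   tanh(y / 2) = 2 coth y - coth(y / 2).
   For a > 0, int_0^oo e^(- a k) S(k) dk = int_0^oo w(x) x / (a^2 + x^2) dx. Taking
   a = n beta, summing over n with coth(y / 2) = 1 + 2 (e^(- y) + e^(- 2 y) + ...), and
   letting a -> 0 in the term n = 0, the coth identity becomes the partial fraction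
   expansion of coth, which comes from integrating cosh(a (PI - t)) against the
   Dirichlet kernel. *)

(** * Absolutely convergent integrals on the half line *)

(** The obstacle is the number of interchanges: two integrals, a sum and an integral, a limit and an
    integral. Each is settled by an inequality with an explicit constant. Integrands are dominated
    by a multiple of 1 / (1 + x^2), whose primitive is atan, so convergence at 0 and at infinity is
    inherited from atan. Decay of order four leaves a factor 1 + x^2 to spend on derivatives in a
    parameter. The order of integration is exchanged by differentiating in the upper limit of one
    integral. Passing to the limit in the damping a, or in the number N of terms, costs an error
    O(a) or O(1 / N), and numbers that differ by at most C a for all small a are equal. The kernels
    have at most a simple pole at 0, cancelled by a zero of w or of S. After pairing k with -k
    nothing diverges, so the finite part is a principal value with zero counterterms. The Fourier
    transform is given only by its pointwise integrals; its continuity and decay are recovered from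
    the transforms of the even and odd parts. *)

Definition dominated (c M : R) (f : R -> R) : Prop :=
  forall x, c < x -> continuous f x /\ Rabs (f x) <= M / (1 + x ^ 2).

Definition admissible (f : R -> R) : Prop := exists M, dominated 0 M f.

(** [RInt_gen] has some value even if the integral diverges, so the laws below ask for [admissible].
    The filter [at_right 0] keeps away from 0 itself, where kernels with a pole only take a default
    value. *)
Definition half_int (f : R -> R) : R :=
  RInt_gen f (at_right 0) (Rbar_locally p_infty).

Lemma one_plus_sqr_pos (x : R) : 0 < 1 + x ^ 2.
Proof. nra. Qed.

Lemma dominated_nonneg (c M : R) (f : R -> R) : dominated c M f -> 0 <= M.
Proof.
  intros H.
  destruct (H (c + 1)) as [_ H1]; [lra|].
  pose proof (Rabs_pos (f (c + 1))).
  pose proof (one_plus_sqr_pos (c + 1)).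
  apply Rmult_le_reg_r with (/ (1 + (c + 1) ^ 2)).
  - now apply Rinv_0_lt_compat.
  - unfold Rdiv in H1. lra.
Qed.

Lemma is_RInt_atan (M p q : R) :
  is_RInt (fun x => M / (1 + x ^ 2)) p q (M * (atan q - atan p)).
Proof.
  replace (M * (atan q - atan p)) with (minus (M * atan q) (M * atan p))
    by (unfold minus, plus, opp; simpl; ring).
  apply (is_RInt_derive (fun x => M * atan x)).
  - intros x _.
    apply (is_derive_ext (fun x => scal M (atan x))); [reflexivity|].
    replace (M / (1 + x ^ 2)) with (scal M (/ (1 + x²)))
      by (unfold scal; simpl; unfold mult, Rsqr; simpl; unfold Rdiv; do 3 f_equal; ring).
    apply @is_derive_scal, is_derive_atan.
  - intros x _. apply @ex_derive_continuous. auto_derive. nra.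
Qed.

Lemma dominated_ex_RInt (c M : R) (f : R -> R) (p q : R) :
  dominated c M f -> c < p -> c < q -> ex_RInt f p q.
Proof.
  intros H Hp Hq. apply @ex_RInt_continuous. intros z [Hz _]. apply H.
  apply Rlt_le_trans with (2 := Hz). now apply Rmin_glb_lt.
Qed.

Lemma dominated_RInt_bound (c M : R) (f : R -> R) (p q l : R) :
  dominated c M f -> c < p -> c < q -> is_RInt f p q l ->
  Rabs l <= M * Rabs (atan q - atan p).
Proof.
  intros H Hp Hq Hl.
  pose proof (dominated_nonneg _ _ _ H) as HM.
  assert (Hle : forall a b v, c < a -> a <= b -> is_RInt f a b v ->
            Rabs v <= M * (atan b - atan a)).
  { intros a b v Ha Hab Hv.
    apply (norm_RInt_le f (fun x => M / (1 + x ^ 2)) a b v); auto.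
    - intros x Hx. apply H. lra.
    - apply is_RInt_atan. }
  destruct (Rle_dec p q) as [Hpq|Hpq].
  - eapply Rle_trans; [apply (Hle _ _ _ Hp Hpq Hl)|].
    apply Rmult_le_compat_l; [exact HM|apply Rle_abs].
  - apply is_RInt_swap in Hl.
    rewrite <- Rabs_Ropp.
    eapply Rle_trans; [apply (Hle q p _ Hq); [lra|exact Hl]|].
    apply Rmult_le_compat_l; [exact HM|].
    rewrite Rabs_minus_sym. apply Rle_abs.
Qed.

(** Cauchy criterion: moving an endpoint changes the integral by at most M times the increment of
    atan, so any two filters along which atan converges will do. This covers 0 from the right, a
    fixed point and infinity at once. *)
Lemma dominated_ex_RInt_gen (c M : R) (f : R -> R) (Fa Fb : (R -> Prop) -> Prop)
    {FFa : ProperFilter Fa} {FFb : ProperFilter Fb} (la lb : R) :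
  dominated c M f -> Fa (fun a => c < a) -> Fb (fun b => c < b) ->
  filterlim atan Fa (locally la) -> filterlim atan Fb (locally lb) ->
  ex_RInt_gen f Fa Fb.
Proof.
  intros H Ha Hb Hla Hlb.
  pose proof (dominated_nonneg _ _ _ H) as HM.
  apply (filterlimi_locally_cauchy (fun ab : R * R => is_RInt f (fst ab) (snd ab))).
  - apply (Filter_prod _ _ _ _ _ Ha Hb). simpl. intros a b Hca Hcb. split.
    + now apply (dominated_ex_RInt c M).
    + intros y1 y2 H1 H2.
      rewrite <- (is_RInt_unique (V := R_CompleteNormedModule) _ _ _ _ H1).
      exact (is_RInt_unique (V := R_CompleteNormedModule) _ _ _ _ H2).
  - intros eps.
    (* Both endpoints move, each changes atan by at most 2 d, and the factor is M; [M + 1] avoids a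
       division by zero. *)
    assert (Hd : 0 < eps / (4 * (M + 1))).
    { apply Rdiv_lt_0_compat; [apply eps|lra]. }
    set (d := mkposreal _ Hd).
    exists (fun ab => (c < fst ab /\ Rabs (atan (fst ab) - la) < d)
                   /\ (c < snd ab /\ Rabs (atan (snd ab) - lb) < d)).
    split.
    + apply Filter_prod with (Q := fun a => c < a /\ Rabs (atan a - la) < d)
        (R := fun b => c < b /\ Rabs (atan b - lb) < d).
      * apply filter_and; [exact Ha|].
        apply (Hla (fun y => Rabs (y - la) < d)). exists d. intros y Hy; exact Hy.
      * apply filter_and; [exact Hb|].
        apply (Hlb (fun y => Rabs (y - lb) < d)). exists d. intros y Hy; exact Hy.
      * simpl. auto.
    + intros [a b] [a' b'] [[Hca Hda] [Hcb Hdb]] [[Hca' Hda'] [Hcb' Hdb']] u v Hu Hv.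
      cbn [fst snd] in *.
      destruct (dominated_ex_RInt c M f a' a) as [v1 Hv1]; auto.
      destruct (dominated_ex_RInt c M f b b') as [v2 Hv2]; auto.
      pose proof (is_RInt_Chasles _ _ _ _ _ _ (is_RInt_Chasles _ _ _ _ _ _ Hv1 Hu) Hv2) as Hs.
      apply (is_RInt_unique (V := R_CompleteNormedModule)) in Hs.
      apply (is_RInt_unique (V := R_CompleteNormedModule)) in Hv. rewrite Hs in Hv.
      apply (dominated_RInt_bound c M) in Hv1; auto.
      apply (dominated_RInt_bound c M) in Hv2; auto.
      subst v. change (Rabs (plus (plus v1 u) v2 - u) < eps).
      unfold plus; simpl.
      replace (v1 + u + v2 - u) with (v1 + v2) by ring.
      assert (E1 : Rabs (atan a - atan a') <= 2 * d).
      { replace (atan a - atan a') with ((atan a - la) - (atan a' - la)) by ring.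
        eapply Rle_trans; [apply Rabs_triang|]. rewrite Rabs_Ropp. lra. }
      assert (E2 : Rabs (atan b' - atan b) <= 2 * d).
      { replace (atan b' - atan b) with ((atan b' - lb) - (atan b - lb)) by ring.
        eapply Rle_trans; [apply Rabs_triang|]. rewrite Rabs_Ropp. lra. }
      eapply Rle_lt_trans; [apply Rabs_triang|].
      apply Rle_lt_trans with (4 * M * d).
      { assert (M * Rabs (atan a - atan a') <= M * (2 * d)) by (apply Rmult_le_compat_l; auto).
        assert (M * Rabs (atan b' - atan b) <= M * (2 * d)) by (apply Rmult_le_compat_l; auto).
        lra. }
      unfold d; simpl.
      pose proof (cond_pos eps).
      replace (pos eps) with (4 * (M + 1) * (eps / (4 * (M + 1)))) at 2 by (field; lra).
      apply Rmult_lt_compat_r; [exact Hd|lra].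
Qed.

Lemma filterlim_atan_p_infty : filterlim atan (Rbar_locally p_infty) (locally (PI / 2)).
Proof.
  apply (filterlim_ext_loc (fun x => PI / 2 - atan (/ x))).
  - exists 0. intros x Hx. rewrite atan_inv; lra.
  - assert (H : filterlim (fun x => atan (/ x)) (Rbar_locally p_infty) (locally 0)).
    { rewrite <- atan_0. apply (filterlim_comp _ _ _ Rinv atan _ (locally 0)).
      - apply (filterlim_Rbar_inv p_infty). discriminate.
      - apply @ex_derive_continuous. auto_derive. exact I. }
    pose proof (filterlim_comp_2 _ _ _ (filterlim_const (PI / 2))
      (filterlim_comp _ _ _ _ _ _ _ _ H (filterlim_opp 0))
      (filterlim_plus (PI / 2) (opp 0))) as H1.
    replace (locally (PI / 2)) with (locally (plus (PI / 2) (opp 0)));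
      [exact H1|f_equal; unfold plus, opp; simpl; ring].
Qed.

Lemma filterlim_atan_at_right (c : R) : filterlim atan (at_right c) (locally (atan c)).
Proof.
  intros P HP. apply filter_le_within.
  assert (Hc : continuous atan c) by (apply @ex_derive_continuous; auto_derive; exact I).
  exact (Hc P HP).
Qed.

Lemma filterlim_atan_at_point (c : R) : filterlim atan (at_point c) (locally (atan c)).
Proof. intros P HP. exact (locally_singleton _ _ HP). Qed.

Lemma at_right_gt (c : R) : at_right c (fun a => c < a).
Proof. exists (mkposreal 1 Rlt_0_1). auto. Qed.

Lemma p_infty_gt (c : R) : Rbar_locally p_infty (fun a => c < a).
Proof. exists c. auto. Qed.

Lemma half_int_correct (f : R -> R) :
  admissible f -> is_RInt_gen f (at_right 0) (Rbar_locally p_infty) (half_int f).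
Proof.
  intros [M H]. apply @RInt_gen_correct; try typeclasses eauto.
  apply (dominated_ex_RInt_gen 0 M f (at_right 0) (Rbar_locally p_infty) (atan 0) (PI / 2)); auto.
  - apply at_right_gt.
  - apply p_infty_gt.
  - apply filterlim_atan_at_right.
  - apply filterlim_atan_p_infty.
Qed.

Lemma half_int_unique (f : R -> R) (l : R) :
  is_RInt_gen f (at_right 0) (Rbar_locally p_infty) l -> half_int f = l.
Proof. apply @is_RInt_gen_unique; typeclasses eauto. Qed.

Lemma dominated_tail_int (c M : R) (f : R -> R) :
  dominated c M f -> forall a, c < a ->
  is_RInt_gen f (at_point a) (Rbar_locally p_infty)
    (RInt_gen f (at_point a) (Rbar_locally p_infty)).
Proof.
  intros H a Ha. apply @RInt_gen_correct; try typeclasses eauto.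
  apply (dominated_ex_RInt_gen c M f (at_point a) (Rbar_locally p_infty) (atan a) (PI / 2)); auto.
  - apply p_infty_gt.
  - apply filterlim_atan_at_point.
  - apply filterlim_atan_p_infty.
Qed.

(** The bridge from truncated integrals to [half_int]: the missing piece over (0, a) is at most M
    (atan a - atan 0). *)
Lemma filterlim_tail_int (f J : R -> R) :
  admissible f ->
  (forall a, 0 < a -> is_RInt_gen f (at_point a) (Rbar_locally p_infty) (J a)) ->
  filterlim J (at_right 0) (locally (half_int f)).
Proof.
  intros [M H] HJ.
  pose proof (dominated_nonneg _ _ _ H) as HM.
  assert (Hb : forall a, 0 < a -> Rabs (J a - half_int f) <= M * Rabs (atan a - atan 0)).
  { intros a Ha.
    assert (Hex : ex_RInt_gen f (at_right 0) (at_point a)).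
    { apply (dominated_ex_RInt_gen 0 M f (at_right 0) (at_point a) (atan 0) (atan a)); auto.
      - apply at_right_gt.
      - apply filterlim_atan_at_right.
      - apply filterlim_atan_at_point. }
    destruct Hex as [l Hl].
    assert (E : half_int f = l + J a).
    { apply half_int_unique. apply @is_RInt_gen_Chasles with a; try typeclasses eauto; auto. }
    assert (Bg : is_RInt_gen (fun x => M / (1 + x ^ 2)) (at_right 0) (at_point a)
              (M * (atan a - atan 0))).
    { apply (filterlimi_lim_ext_loc (fun ab : R * R => M * (atan (snd ab) - atan (fst ab)))).
      - apply filter_forall. intros [p q]. apply is_RInt_atan.
      - apply (filterlim_comp_2 (G := locally (atan a)) (H := locally (atan 0))
          (fun ab : R * R => atan (snd ab)) (fun ab : R * R => atan (fst ab))
          (fun y x => M * (y - x))).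
        + eapply filterlim_comp; [apply filterlim_snd|apply filterlim_atan_at_point].
        + eapply filterlim_comp; [apply filterlim_fst|apply filterlim_atan_at_right].
        + assert (Hm := filterlim_comp _ _ _ _ _ _ _ _ (filterlim_comp_2 _ _ plus filterlim_fst
            (filterlim_comp _ _ _ _ _ _ _ _ filterlim_snd (filterlim_opp (atan 0)))
            (filterlim_plus (atan a) (opp (atan 0))))
            (filterlim_scal_r M (plus (atan a) (opp (atan 0))))).
          exact Hm. }
    assert (Hn : Rabs l <= M * (atan a - atan 0)).
    { apply (RInt_gen_norm (Fa := at_right 0) (Fb := at_point a) f (fun x => M / (1 + x ^ 2))); auto.
      - apply Filter_prod with (Q := fun p => 0 < p < a) (R := fun q => q = a).
        + apply (filter_and (F := at_right 0)); [apply at_right_gt|].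
          exists (mkposreal a Ha). intros y Hy _.
          change (Rabs (y - 0) < a) in Hy. rewrite Rminus_0_r in Hy.
          pose proof (Rle_abs y). lra.
        + reflexivity.
        + intros p q Hp ->. simpl. lra.
      - apply Filter_prod with (Q := fun p => 0 < p) (R := fun q => True).
        + apply at_right_gt.
        + exact I.
        + intros p q Hp _ x Hx. simpl in Hx. apply H. lra. }
    rewrite E. replace (J a - (l + J a)) with (- l) by ring. rewrite Rabs_Ropp.
    eapply Rle_trans; [exact Hn|].
    apply Rmult_le_compat_l; [exact HM|apply Rle_abs]. }
  apply filterlim_locally. intros eps.
  assert (Hd : 0 < eps / (M + 1)).
  { apply Rdiv_lt_0_compat; [apply eps|lra]. }
  pose proof (filterlim_atan_at_right 0 _ (locally_ball (atan 0) (mkposreal _ Hd))) as Hn.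
  unfold filtermap in Hn.
  generalize (filter_and _ _ Hn (at_right_gt 0)). apply filter_imp.
  intros a [Ha1 Ha2]. change (Rabs (J a - half_int f) < eps).
  change (Rabs (atan a - atan 0) < eps / (M + 1)) in Ha1.
  eapply Rle_lt_trans; [apply Hb; auto|].
  pose proof (Rabs_pos (atan a - atan 0)).
  apply Rle_lt_trans with ((M + 1) * Rabs (atan a - atan 0)); [nra|].
  replace (pos eps) with ((M + 1) * (eps / (M + 1))) by (field; lra).
  apply Rmult_lt_compat_l; lra.
Qed.

Lemma admissible_ext (f g : R -> R) :
  (forall x, 0 < x -> f x = g x) -> admissible f -> admissible g.
Proof.
  intros E [M H]. exists M. intros x Hx. destruct (H x Hx) as [Hc Hb]. split.
  - apply (continuous_ext_loc _ f); [|exact Hc].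
    exists (mkposreal x Hx). intros y Hy. apply E.
    change (Rabs (y - x) < x) in Hy. apply Rabs_def2 in Hy. lra.
  - rewrite <- E; auto.
Qed.

Lemma half_int_ext (f g : R -> R) :
  (forall x, 0 < x -> f x = g x) -> admissible f -> half_int f = half_int g.
Proof.
  intros E H. symmetry. apply half_int_unique.
  apply (is_RInt_gen_ext f); [|now apply half_int_correct].
  apply Filter_prod with (Q := fun p => 0 < p) (R := fun q => 0 < q).
  - apply at_right_gt.
  - apply p_infty_gt.
  - intros p q Hp Hq x [Hx _]. apply E. simpl in Hx.
    apply Rlt_trans with (2 := Hx). now apply Rmin_glb_lt.
Qed.

Lemma admissible_plus (f g : R -> R) :
  admissible f -> admissible g -> admissible (fun x => f x + g x).
Proof.
  intros [M H] [N K]. exists (M + N). intros x Hx.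
  destruct (H x Hx) as [Hc Hb]. destruct (K x Hx) as [Kc Kb]. split.
  - apply (continuous_plus f g); auto.
  - eapply Rle_trans; [apply Rabs_triang|]. unfold Rdiv in *. lra.
Qed.

Lemma admissible_scal (c : R) (f : R -> R) :
  admissible f -> admissible (fun x => c * f x).
Proof.
  intros [M H]. exists (Rabs c * M). intros x Hx.
  destruct (H x Hx) as [Hc Hb]. split.
  - apply (continuous_scal_r c f); auto.
  - rewrite Rabs_mult. unfold Rdiv in *. rewrite Rmult_assoc.
    apply Rmult_le_compat_l; [apply Rabs_pos|exact Hb].
Qed.

Lemma admissible_minus (f g : R -> R) :
  admissible f -> admissible g -> admissible (fun x => f x - g x).
Proof.
  intros Hf Hg. apply (admissible_ext (fun x => f x + (-1) * g x)).
  - intros; ring.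
  - apply admissible_plus; auto. now apply admissible_scal.
Qed.

Lemma half_int_plus (f g : R -> R) :
  admissible f -> admissible g ->
  half_int (fun x => f x + g x) = half_int f + half_int g.
Proof.
  intros Hf Hg. apply half_int_unique.
  apply @is_RInt_gen_plus; try typeclasses eauto; now apply half_int_correct.
Qed.

Lemma half_int_scal (c : R) (f : R -> R) :
  admissible f -> half_int (fun x => c * f x) = c * half_int f.
Proof.
  intros Hf. apply half_int_unique.
  apply @is_RInt_gen_scal; try typeclasses eauto; now apply half_int_correct.
Qed.

Lemma half_int_minus (f g : R -> R) :
  admissible f -> admissible g ->
  half_int (fun x => f x - g x) = half_int f - half_int g.
Proof.
  intros Hf Hg. apply half_int_unique.
  apply @is_RInt_gen_minus; try typeclasses eauto; now apply half_int_correct.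
Qed.

Lemma half_int_abs_le (f g : R -> R) :
  admissible f -> admissible g -> (forall x, 0 < x -> Rabs (f x) <= g x) ->
  Rabs (half_int f) <= half_int g.
Proof.
  intros Hf Hg H.
  apply (RInt_gen_norm (Fa := at_right 0) (Fb := Rbar_locally p_infty) f g);
    try (now apply half_int_correct).
  - apply Filter_prod with (Q := fun p => p < 1) (R := fun q => 1 < q).
    + exists (mkposreal 1 Rlt_0_1). intros y Hy _. change (Rabs (y - 0) < 1) in Hy.
      apply Rabs_def2 in Hy. lra.
    + apply p_infty_gt.
    + simpl. intros; lra.
  - apply Filter_prod with (Q := fun p => 0 < p) (R := fun q => True).
    + apply at_right_gt.
    + now exists 0.
    + intros p q Hp _ x Hx. simpl in Hx. apply H. lra.
Qed.

Lemma half_int_derive (F f : R -> R) (la lb : R) :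
  (forall x, 0 < x -> is_derive F x (f x)) ->
  (forall x, 0 < x -> continuous f x) ->
  filterlim F (at_right 0) (locally la) ->
  filterlim F (Rbar_locally p_infty) (locally lb) ->
  half_int f = lb - la.
Proof.
  intros HF Hf Ha Hb. apply half_int_unique.
  apply (filterlimi_lim_ext_loc (fun ab : R * R => minus (F (snd ab)) (F (fst ab)))).
  - apply Filter_prod with (Q := fun p => 0 < p) (R := fun q => 0 < q).
    + apply at_right_gt.
    + apply p_infty_gt.
    + intros p q Hp Hq. simpl.
      assert (Hpos : forall x, Rmin p q <= x <= Rmax p q -> 0 < x).
      { intros x [Hx _]. apply Rlt_le_trans with (2 := Hx). now apply Rmin_glb_lt. }
      apply (is_RInt_derive F); auto.
  - apply (filterlim_comp_2 (G := locally lb) (H := locally (opp la)) (fun ab : R * R => F (snd ab))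
      (fun ab : R * R => opp (F (fst ab)))).
    + eapply filterlim_comp; [apply filterlim_snd|exact Hb].
    + eapply filterlim_comp; [eapply filterlim_comp; [apply filterlim_fst|exact Ha]|].
      apply (filterlim_opp la).
    + apply (filterlim_plus lb (opp la)).
Qed.

(** * Trigonometric transforms *)

(** The square is a reserve: after multiplication by a function of size 1 + x^2 the product is still
    [admissible]. *)
Definition fast (f : R -> R) : Prop :=
  exists M, forall x, 0 < x -> continuous f x /\ Rabs (f x) <= M / (1 + x ^ 2) ^ 2.

Lemma fast_mult (f g : R -> R) (C : R) :
  fast f -> (forall x, 0 < x -> continuous g x) ->
  (forall x, 0 < x -> Rabs (g x) <= C * (1 + x ^ 2)) ->
  admissible (fun x => f x * g x).
Proof.
  intros [M H] Hc Hg. exists (M * C). intros x Hx. destruct (H x Hx) as [Hfc Hfb]. split.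
  - apply (continuous_mult f g); auto.
  - rewrite Rabs_mult. pose proof (one_plus_sqr_pos x).
    replace (M * C / (1 + x ^ 2)) with (M / (1 + x ^ 2) ^ 2 * (C * (1 + x ^ 2)))
      by (field; lra).
    apply Rmult_le_compat; auto using Rabs_pos.
Qed.

Lemma fast_admissible (f : R -> R) : fast f -> admissible f.
Proof.
  intros H. apply (admissible_ext (fun x => f x * 1)); [intros; ring|].
  apply fast_mult with 1; auto.
  - intros; apply continuous_const.
  - intros. rewrite Rabs_R1. nra.
Qed.

Lemma fast_abs (f : R -> R) : fast f -> fast (fun x => Rabs (f x)).
Proof.
  intros [M H]. exists M. intros x Hx. destruct (H x Hx). split.
  - apply (continuous_comp f Rabs); auto. apply continuous_Rabs.
  - now rewrite Rabs_Rabsolu.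
Qed.

Lemma continuous_sqr_weight (C x : R) : continuous (fun x => C * (1 + x ^ 2)) x.
Proof. apply @ex_derive_continuous. auto_derive. exact I. Qed.

Lemma fast_weight_admissible (f : R -> R) (C : R) :
  fast f -> admissible (fun x => Rabs (f x) * (C * (1 + x ^ 2))).
Proof.
  intros H. apply (fast_mult _ (fun x => C * (1 + x ^ 2)) (Rabs C)); auto using fast_abs.
  - intros; apply continuous_sqr_weight.
  - intros x _. rewrite Rabs_mult, (Rabs_pos_eq (1 + x ^ 2)); [lra|].
    apply Rlt_le, one_plus_sqr_pos.
Qed.

(** The replacement for dominated convergence: with f fixed, smallness of g relative to the weight 1
    + x^2 passes linearly to the integral. *)
Lemma half_int_weight_bound (f g : R -> R) (C : R) :
  fast f -> admissible (fun x => f x * g x) ->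
  (forall x, 0 < x -> Rabs (g x) <= C * (1 + x ^ 2)) ->
  Rabs (half_int (fun x => f x * g x)) <=
  C * half_int (fun x => Rabs (f x) * (1 * (1 + x ^ 2))).
Proof.
  intros Hf Hfg Hg.
  rewrite <- half_int_scal by (now apply fast_weight_admissible).
  apply half_int_abs_le; auto.
  - apply admissible_scal. now apply fast_weight_admissible.
  - intros x Hx. rewrite Rabs_mult.
    replace (C * (Rabs (f x) * (1 * (1 + x ^ 2)))) with (Rabs (f x) * (C * (1 + x ^ 2))) by ring.
    apply Rmult_le_compat_l; auto using Rabs_pos.
Qed.

(** Locating c by its distance to a makes the statement independent of the order of a and b. *)
Lemma mean_value (f df : R -> R) (a b : R) :
  (forall x, is_derive f x (df x)) ->
  exists c, Rabs (c - a) <= Rabs (b - a) /\ f b - f a = df c * (b - a).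
Proof.
  intros H. destruct (MVT_gen f a b df) as [c [Hc E]].
  - intros x _. apply H.
  - intros x _. apply continuity_pt_filterlim.
    apply @ex_derive_continuous. now exists (df x).
  - exists c. split; [|exact E].
    revert Hc. unfold Rmin, Rmax, Rabs.
    destruct (Rle_dec a b), (Rcase_abs (c - a)), (Rcase_abs (b - a)); lra.
Qed.

(** By the mean value theorem G(t0 + h) - G(t0) - h G1(t0) equals h (G1(c) - G1(t0)), and the
    Lipschitz hypothesis makes this C (1 + x^2) h^2. The weighted bound then gives an error
    quadratic in h. *)
Lemma is_derive_half_int (f : R -> R) (G G1 : R -> R -> R) (t0 C : R) :
  fast f ->
  (forall t x, 0 < x -> is_derive (fun t => G t x) t (G1 t x)) ->
  (forall t, admissible (fun x => f x * G t x)) ->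
  admissible (fun x => f x * G1 t0 x) ->
  (forall t x, 0 < x -> Rabs (t - t0) < 1 ->
     Rabs (G1 t x - G1 t0 x) <= C * (1 + x ^ 2) * Rabs (t - t0)) ->
  is_derive (fun t => half_int (fun x => f x * G t x)) t0
    (half_int (fun x => f x * G1 t0 x)).
Proof.
  intros Hf HG Ha Ha1 HL.
  set (K := half_int (fun x => Rabs (f x) * (1 * (1 + x ^ 2)))).
  assert (HK : 0 <= K).
  { eapply Rle_trans; [apply Rabs_pos|].
    apply (half_int_abs_le (fun x => f x)); [now apply fast_admissible| |].
    - now apply fast_weight_admissible.
    - intros x _. pose proof (Rabs_pos (f x)). nra. }
  apply is_derive_Reals. intros eps Heps.
  (* The 1 keeps the intermediate point in the range of the Lipschitz hypothesis; the quotient makes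
     the error |C| K |h| smaller than eps. [Rabs C] is used because C has no prescribed sign. *)
  assert (Hd0 : 0 < Rmin 1 (eps / (Rabs C * K + 1))).
  { apply Rmin_glb_lt; [lra|]. apply Rdiv_lt_0_compat; auto.
    pose proof (Rmult_le_pos _ _ (Rabs_pos C) HK). lra. }
  exists (mkposreal _ Hd0). intros h Hh Hhd. simpl in Hhd.
  assert (Hh1 : Rabs h < 1) by (eapply Rlt_le_trans; [exact Hhd|apply Rmin_l]).
  assert (Hh2 : Rabs h < eps / (Rabs C * K + 1)) by (eapply Rlt_le_trans; [exact Hhd|apply Rmin_r]).
  assert (HCK : 0 < Rabs C * K + 1) by (pose proof (Rmult_le_pos _ _ (Rabs_pos C) HK); lra).
  assert (Hpos : 0 < Rabs h) by (now apply Rabs_pos_lt).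
  assert (Hest : Rabs (half_int (fun x => f x * (G (t0 + h) x - G t0 x - h * G1 t0 x)))
            <= (Rabs C * Rabs h * Rabs h) * K).
  { apply half_int_weight_bound; auto.
    - apply (admissible_ext (fun x => f x * G (t0 + h) x - f x * G t0 x - h * (f x * G1 t0 x))).
      { intros; ring. }
      apply admissible_minus; [apply admissible_minus; auto|now apply admissible_scal].
    - intros x Hx.
      destruct (mean_value (fun t => G t x) (fun t => G1 t x) t0 (t0 + h)) as [c [Hc E]].
      { intros t; now apply HG. }
      replace (t0 + h - t0) with h in * by ring.
      rewrite E. replace (G1 c x * h - h * G1 t0 x) with ((G1 c x - G1 t0 x) * h) by ring.
      rewrite Rabs_mult.
      pose proof (HL c x Hx (Rle_lt_trans _ _ _ Hc Hh1)) as HLc.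
      pose proof (one_plus_sqr_pos x).
      replace (Rabs C * Rabs h * Rabs h * (1 + x ^ 2))
        with (Rabs C * (1 + x ^ 2) * Rabs h * Rabs h) by ring.
      apply Rmult_le_compat_r; [lra|].
      eapply Rle_trans; [exact HLc|].
      apply Rle_trans with (Rabs C * (1 + x ^ 2) * Rabs (c - t0)).
      + apply Rmult_le_compat_r; [apply Rabs_pos|].
        apply Rmult_le_compat_r; [lra|apply Rle_abs].
      + apply Rmult_le_compat_l; auto.
        apply Rmult_le_pos; [apply Rabs_pos|lra]. }
  assert (Eq : half_int (fun x => f x * (G (t0 + h) x - G t0 x - h * G1 t0 x))
     = half_int (fun x => f x * G (t0 + h) x) - half_int (fun x => f x * G t0 x)
       - h * half_int (fun x => f x * G1 t0 x)).
  { rewrite <- half_int_scal, <- half_int_minus, <- half_int_minus;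
      auto using admissible_minus, admissible_scal.
    symmetry. apply half_int_ext; [intros; ring|].
    apply admissible_minus; [apply admissible_minus; auto|now apply admissible_scal]. }
  rewrite Eq in Hest. revert Hest.
  generalize (half_int (fun x => f x * G (t0 + h) x)) (half_int (fun x => f x * G t0 x))
    (half_int (fun x => f x * G1 t0 x)).
  intros A B D Hest.
  replace ((A - B) / h - D) with ((A - B - h * D) / h) by (field; auto).
  rewrite Rabs_div by auto.
  apply Rle_lt_trans with (Rabs C * K * Rabs h).
  - apply Rmult_le_reg_r with (Rabs h); auto.
    replace (Rabs (A - B - h * D) / Rabs h * Rabs h) with (Rabs (A - B - h * D)) by (field; lra).
    lra.
  - apply Rle_lt_trans with ((Rabs C * K + 1) * Rabs h); [nra|].
    replace eps with ((Rabs C * K + 1) * (eps / (Rabs C * K + 1))) by (field; lra).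
    apply Rmult_lt_compat_l; auto.
Qed.

Lemma Rabs_cos_le_1 (x : R) : Rabs (cos x) <= 1.
Proof. apply Rabs_le. destruct (COS_bound x); lra. Qed.

Lemma Rabs_sin_le_1 (x : R) : Rabs (sin x) <= 1.
Proof. apply Rabs_le. destruct (SIN_bound x); lra. Qed.

(* [theta = 0] and [theta = PI / 2] give the half-line cosine and sine transforms. *)
Definition trig_transform (theta : R) (f : R -> R) (k : R) : R :=
  half_int (fun x => f x * cos (k * x - theta)).

Lemma trig_admissible (theta k : R) (f : R -> R) :
  fast f -> admissible (fun x => f x * cos (k * x - theta)).
Proof.
  intros Hf. apply (fast_mult f (fun x => cos (k * x - theta)) 1); auto.
  - intros. apply @ex_derive_continuous. auto_derive. exact I.
  - intros x _. pose proof (Rabs_cos_le_1 (k * x - theta)). nra.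
Qed.

Lemma trig_transform_bounded (theta k : R) (f : R -> R) :
  fast f -> Rabs (trig_transform theta f k) <=
    half_int (fun x => Rabs (f x) * (1 * (1 + x ^ 2))).
Proof.
  intros Hf. unfold trig_transform.
  rewrite <- (Rmult_1_l (half_int (fun x => Rabs (f x) * (1 * (1 + x ^ 2))))).
  apply half_int_weight_bound; auto using trig_admissible.
  intros x _. pose proof (Rabs_cos_le_1 (k * x - theta)). nra.
Qed.

(** Two derivatives of the kernel in k cost x^2, exactly what the weight allows. Later uses need
    only the continuity that follows. *)
Lemma ex_derive_trig_transform (theta k : R) (f : R -> R) :
  fast f -> ex_derive (trig_transform theta f) k.
Proof.
  intros Hf. eexists. unfold trig_transform.
  apply (is_derive_half_int f (fun k x => cos (k * x - theta))
    (fun k x => - x * sin (k * x - theta)) k 1); auto using trig_admissible.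
  - intros t x _. auto_derive; [exact I|unfold Rminus; ring].
  - apply (fast_mult f (fun x => - x * sin (k * x - theta)) 1); auto.
    + intros. apply @ex_derive_continuous. auto_derive. exact I.
    + intros x Hx. rewrite Rabs_mult, Rabs_Ropp, (Rabs_pos_eq x) by lra.
      pose proof (Rabs_sin_le_1 (k * x - theta)).
      apply Rle_trans with (x * 1); [apply Rmult_le_compat_l; lra|nra].
  - intros t x Hx _.
    destruct (mean_value (fun t => - x * sin (t * x - theta))
      (fun t => - x * x * cos (t * x - theta)) k t) as [c [_ E]].
    { intros s. auto_derive; [exact I|unfold Rminus; ring]. }
    rewrite E, !Rabs_mult. apply Rmult_le_compat_r; [apply Rabs_pos|].
    rewrite Rabs_Ropp, Rabs_pos_eq by lra.
    pose proof (Rabs_cos_le_1 (c * x - theta)).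
    apply Rle_trans with (x * x * 1); [apply Rmult_le_compat_l; nra|nra].
Qed.

(** The sine transform has a zero at k = 0 because |sin(k x)| <= k x; this zero absorbs the pole of
    1 / (e^(beta k) - 1). *)
Lemma trig_transform_small (f : R -> R) (k : R) :
  fast f -> 0 < k -> Rabs (trig_transform (PI / 2) f k) <=
    k * half_int (fun x => Rabs (f x) * (1 * (1 + x ^ 2))).
Proof.
  intros Hf Hk. apply half_int_weight_bound; auto using trig_admissible.
  intros x Hx. replace (k * x - PI / 2) with (- (PI / 2 - k * x)) by ring.
  rewrite cos_neg, cos_shift.
  destruct (mean_value sin cos 0 (k * x)) as [c [_ E]].
  { intros t. auto_derive; [exact I|unfold Rminus; ring]. }
  rewrite sin_0 in E. rewrite !Rminus_0_r in E. rewrite E.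
  rewrite Rabs_mult, (Rabs_pos_eq (k * x)) by (apply Rmult_le_pos; lra).
  pose proof (Rabs_cos_le_1 c).
  apply Rle_trans with (1 * (k * x)); [apply Rmult_le_compat_r; nra|].
  assert (x <= 1 + x ^ 2) by nra. rewrite Rmult_1_l. apply Rmult_le_compat_l; lra.
Qed.

(** * Exchange of integrals and Laplace transforms of the trigonometric transforms *)

Lemma filterlim_squeeze (F : (R -> Prop) -> Prop) {FF : Filter F} (f g : R -> R) (l : R) :
  F (fun x => Rabs (f x - l) <= g x) -> filterlim g F (locally 0) ->
  filterlim f F (locally l).
Proof.
  intros H Hg. apply filterlim_locally. intros eps.
  pose proof (Hg _ (locally_ball 0 eps)) as H1. unfold filtermap in H1.
  generalize (filter_and _ _ H H1). apply filter_imp. intros x [Hx1 Hx2].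
  change (Rabs (g x - 0) < eps) in Hx2. change (Rabs (f x - l) < eps).
  eapply Rle_lt_trans; [exact Hx1|]. rewrite Rminus_0_r in Hx2.
  eapply Rle_lt_trans; [apply Rle_abs|exact Hx2].
Qed.

Lemma filterlim_at_right_0 (f : R -> R) :
  continuous f 0 -> filterlim f (at_right 0) (locally (f 0)).
Proof. intros H P HP. apply filter_le_within. exact (H P HP). Qed.

(** Here G(t, x) plays the integral of G1(s, x) over s in (0, t). The function t -> int f G(t, .)
    has derivative int f G1(t, .), vanishes at t = 0 and tends to int f Ginf, so the fundamental
    theorem of calculus evaluates the iterated integral. *)
Lemma half_int_exchange (f Ginf : R -> R) (G G1 : R -> R -> R) (a C : R) :
  0 < a -> fast f ->
  (forall t x, 0 < x -> is_derive (fun t => G t x) t (G1 t x)) ->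
  (forall t, admissible (fun x => f x * G t x)) ->
  (forall t, admissible (fun x => f x * G1 t x)) ->
  admissible (fun x => f x * Ginf x) ->
  (forall t0, exists C, forall t x, 0 < x -> Rabs (t - t0) < 1 ->
     Rabs (G1 t x - G1 t0 x) <= C * (1 + x ^ 2) * Rabs (t - t0)) ->
  (forall x, 0 < x -> G 0 x = 0) ->
  (forall t x, 0 < x -> Rabs (G t x - Ginf x) <= C * exp (- a * t) * (1 + x ^ 2)) ->
  (forall k, 0 < k -> continuous (fun k => half_int (fun x => f x * G1 k x)) k) ->
  half_int (fun k => half_int (fun x => f x * G1 k x)) = half_int (fun x => f x * Ginf x).
Proof.
  intros Ha Hf HG HaG HaG1 Hinf HL H0 HC Hcont.
  set (K := half_int (fun x => Rabs (f x) * (1 * (1 + x ^ 2)))).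
  assert (HD : forall t, is_derive (fun t => half_int (fun x => f x * G t x)) t
                 (half_int (fun x => f x * G1 t x))).
  { intros t. destruct (HL t) as [Ct HCt]. now apply is_derive_half_int with Ct. }
  rewrite (half_int_derive (fun t => half_int (fun x => f x * G t x))
    (fun k => half_int (fun x => f x * G1 k x)) 0 (half_int (fun x => f x * Ginf x))); auto.
  - ring.
  - replace 0 with (half_int (fun x => f x * G 0 x)) at 2.
    + apply (filterlim_at_right_0 (fun t => half_int (fun x => f x * G t x))).
      apply @ex_derive_continuous. eexists. apply HD.
    + rewrite (half_int_ext (fun x => f x * G 0 x) (fun x => 0 * (f x * G 0 x))); auto.
      * rewrite half_int_scal by auto. ring.
      * intros x Hx. rewrite H0; auto. ring.
  - apply (filterlim_squeeze _ _ (fun t => C * exp (- a * t) * K)).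
    + exists 0. intros t _. rewrite <- half_int_minus; auto.
      rewrite (half_int_ext _ (fun x => f x * (G t x - Ginf x))); auto using admissible_minus.
      2: intros; ring.
      apply half_int_weight_bound; auto.
      apply (admissible_ext (fun x => f x * G t x - f x * Ginf x)); auto using admissible_minus.
      intros; ring.
    + apply (filterlim_ext (fun t => scal (C * K) (exp (- a * t)))).
      { intros; unfold scal; simpl; unfold mult; simpl; ring. }
      replace 0 with (scal (C * K) 0) by (unfold scal; simpl; unfold mult; simpl; ring).
      eapply filterlim_comp; [|apply (filterlim_scal_r (C * K) 0)].
      apply (filterlim_comp _ _ _ (fun t => - a * t) exp _ (Rbar_locally m_infty)).
      * intros P [m HP]. exists (- m / a). intros t Ht. apply HP.
        apply Rmult_lt_compat_l with (r := a) in Ht; auto.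
        replace (a * (- m / a)) with (- m) in Ht by (field; lra). lra.
      * apply is_lim_exp_m.
Qed.

(** The integral of e^(- a s) cos(s x - theta) over s in (0, t); the second bracket normalizes it to
    vanish at t = 0 and is all that survives as t grows. *)
Definition laplace_kernel (a theta t x : R) : R :=
  (exp (- a * t) * (x * sin (t * x - theta) - a * cos (t * x - theta))
   + (x * sin theta + a * cos theta)) / (a ^ 2 + x ^ 2).

Lemma sum_sqr_pos (a x : R) : 0 < a -> 0 < a ^ 2 + x ^ 2.
Proof. intros; nra. Qed.

(** Both a x and a^2 are at most a^2 + x^2, whence the 2 / a. It blows up as a -> 0, but is only
    used with a fixed. *)
Lemma lorentz_weight (a x : R) : 0 < a -> 0 < x ->
  (x + a) / (a ^ 2 + x ^ 2) <= (2 / a) * (1 + x ^ 2).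
Proof.
  intros Ha Hx. pose proof (sum_sqr_pos a x Ha).
  apply Rmult_le_reg_r with (a ^ 2 + x ^ 2); auto.
  replace ((x + a) / (a ^ 2 + x ^ 2) * (a ^ 2 + x ^ 2)) with (x + a) by (field; lra).
  apply Rmult_le_reg_r with a; auto.
  replace (2 / a * (1 + x ^ 2) * (a ^ 2 + x ^ 2) * a)
    with (2 * (1 + x ^ 2) * (a ^ 2 + x ^ 2)) by (field; lra).
  assert (a * x <= a ^ 2 + x ^ 2) by nra.
  assert (0 <= x ^ 2 * (a ^ 2 + x ^ 2)) by nra.
  nra.
Qed.

Lemma trig_comb_bound (a x s c : R) :
  0 < a -> 0 < x -> Rabs s <= 1 -> Rabs c <= 1 -> Rabs (x * s + a * c) <= x + a.
Proof.
  intros Ha Hx Hs Hc. eapply Rle_trans; [apply Rabs_triang|].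
  rewrite !Rabs_mult, (Rabs_pos_eq x), (Rabs_pos_eq a) by lra. nra.
Qed.

Lemma lorentz_comb_weight (a x s c : R) :
  0 < a -> 0 < x -> Rabs s <= 1 -> Rabs c <= 1 ->
  Rabs ((x * s + a * c) / (a ^ 2 + x ^ 2)) <= (2 / a) * (1 + x ^ 2).
Proof.
  intros Ha Hx Hs Hc. pose proof (sum_sqr_pos a x Ha) as Hp.
  rewrite Rabs_div, (Rabs_pos_eq (a ^ 2 + x ^ 2)) by lra.
  eapply Rle_trans; [|apply lorentz_weight; auto].
  apply Rmult_le_compat_r; [apply Rlt_le, Rinv_0_lt_compat; auto|].
  now apply trig_comb_bound.
Qed.

Lemma lorentz_admissible (a theta : R) (f : R -> R) :
  0 < a -> fast f ->
  admissible (fun x => f x * ((x * sin theta + a * cos theta) / (a ^ 2 + x ^ 2))).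
Proof.
  intros Ha Hf.
  apply (fast_mult f (fun x => (x * sin theta + a * cos theta) / (a ^ 2 + x ^ 2)) (2 / a)); auto.
  - intros x Hx. apply @ex_derive_continuous. auto_derive. pose proof (sum_sqr_pos a x Ha). simpl in *; lra.
  - intros x Hx. apply lorentz_comb_weight; auto using Rabs_sin_le_1, Rabs_cos_le_1.
Qed.

Lemma half_int_laplace_trig_transform (a theta : R) (f : R -> R) :
  0 < a -> fast f ->
  half_int (fun k => exp (- a * k) * trig_transform theta f k) =
  half_int (fun x => f x * ((x * sin theta + a * cos theta) / (a ^ 2 + x ^ 2))).
Proof.
  intros Ha Hf.
  set (G1 := fun t x => exp (- a * t) * cos (t * x - theta)).
  assert (HaG1 : forall t, admissible (fun x => f x * G1 t x)).
  { intros t. apply (admissible_ext (fun x => exp (- a * t) * (f x * cos (t * x - theta)))).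
    - intros; unfold G1; ring.
    - apply admissible_scal. now apply trig_admissible. }
  assert (E : forall k, exp (- a * k) * trig_transform theta f k = half_int (fun x => f x * G1 k x)).
  { intros k. unfold trig_transform. rewrite <- half_int_scal by (now apply trig_admissible).
    apply half_int_ext; [intros; unfold G1; ring|].
    apply admissible_scal. now apply trig_admissible. }
  assert (Hdiff : forall t x, 0 < x -> Rabs (laplace_kernel a theta t x
            - (x * sin theta + a * cos theta) / (a ^ 2 + x ^ 2))
            <= 2 / a * exp (- a * t) * (1 + x ^ 2)).
  { intros t x Hx. pose proof (sum_sqr_pos a x Ha) as Hp.
    replace (laplace_kernel a theta t x - (x * sin theta + a * cos theta) / (a ^ 2 + x ^ 2))
      with (exp (- a * t) * ((x * sin (t * x - theta) + a * - cos (t * x - theta)) / (a ^ 2 + x ^ 2)))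
      by (unfold laplace_kernel; field; lra).
    rewrite Rabs_mult, (Rabs_pos_eq (exp _)) by (apply Rlt_le, exp_pos).
    replace (2 / a * exp (- a * t) * (1 + x ^ 2)) with (exp (- a * t) * (2 / a * (1 + x ^ 2))) by ring.
    apply Rmult_le_compat_l; [apply Rlt_le, exp_pos|].
    apply lorentz_comb_weight; auto using Rabs_sin_le_1.
    rewrite Rabs_Ropp. apply Rabs_cos_le_1. }
  transitivity (half_int (fun k => half_int (fun x => f x * G1 k x))).
  { apply (f_equal half_int). apply functional_extensionality. exact E. }
  apply (half_int_exchange f (fun x => (x * sin theta + a * cos theta) / (a ^ 2 + x ^ 2))
    (laplace_kernel a theta) G1 a (2 / a)); auto.
  - intros t x Hx. pose proof (sum_sqr_pos a x Ha) as Hp. unfold laplace_kernel, G1.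
    auto_derive; [exact I|]. unfold Rminus, Rdiv. simpl in Hp. field. simpl. lra.
  - intros t.
    apply (admissible_ext (fun x => f x * (laplace_kernel a theta t x
       - (x * sin theta + a * cos theta) / (a ^ 2 + x ^ 2))
       + f x * ((x * sin theta + a * cos theta) / (a ^ 2 + x ^ 2)))).
    { intros; ring. }
    apply admissible_plus; [|now apply lorentz_admissible].
    apply (fast_mult f (fun x => laplace_kernel a theta t x
       - (x * sin theta + a * cos theta) / (a ^ 2 + x ^ 2)) (2 / a * exp (- a * t))); auto.
    intros x Hx. apply @ex_derive_continuous. unfold laplace_kernel. auto_derive.
    pose proof (sum_sqr_pos a x Ha) as Hp. simpl in *; lra.
  - now apply lorentz_admissible.
  (* The derivative of G1 in t is - e^(- a t) (x sin + a cos). Since t may be negative, the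
     exponential is bounded through |t| <= |t0| + 1; the bracket is at most x + a <= (1 + a) (1 +
     x^2). *)
  - intros t0. exists (exp (a * (Rabs t0 + 1)) * (1 + a)). intros t x Hx Ht. unfold G1.
    destruct (mean_value (fun t => exp (- a * t) * cos (t * x - theta))
      (fun t => - exp (- a * t) * (x * sin (t * x - theta) + a * cos (t * x - theta))) t0 t)
      as [c [Hc Ec]].
    { intros s. auto_derive; [exact I|unfold Rminus; ring]. }
    rewrite Ec, !Rabs_mult, Rabs_Ropp. apply Rmult_le_compat_r; [apply Rabs_pos|].
    rewrite Rmult_assoc. apply Rmult_le_compat; try apply Rabs_pos.
    + rewrite Rabs_pos_eq by (apply Rlt_le, exp_pos).
      assert (Hle : - a * c <= a * (Rabs t0 + 1)).
      { assert (- c <= Rabs t0 + 1).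
        { pose proof (Rle_abs (- t0)) as H1. rewrite Rabs_Ropp in H1.
          pose proof (Rle_abs (- (c - t0))) as H2. rewrite Rabs_Ropp in H2. lra. }
        nra. }
      destruct Hle as [Hle|Hle]; [left; now apply exp_increasing|right; now rewrite Hle].
    + eapply Rle_trans; [apply trig_comb_bound; auto using Rabs_sin_le_1, Rabs_cos_le_1|].
      assert (x <= 1 + x ^ 2) by nra. assert (0 <= a * x ^ 2) by nra. lra.
  - intros x Hx. unfold laplace_kernel. pose proof (sum_sqr_pos a x Ha) as Hp.
    rewrite Rmult_0_r, exp_0, Rmult_0_l, Rminus_0_l, sin_neg, cos_neg. field. lra.
  - intros k Hk. apply (continuous_ext (fun k => exp (- a * k) * trig_transform theta f k)); auto.
    apply (continuous_mult (fun k => exp (- a * k)) (trig_transform theta f)).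
    + apply @ex_derive_continuous. auto_derive. exact I.
    + apply @ex_derive_continuous. now apply ex_derive_trig_transform.
Qed.

(** * Schwartz functions *)

Lemma schwartz_ex_derive (u : R -> R) (x : R) : schwartz_R u -> ex_derive u x.
Proof. intros [H _]. exact (H 1%nat x). Qed.

Lemma schwartz_continuous (u : R -> R) (x : R) : schwartz_R u -> continuous u x.
Proof. intros H. apply @ex_derive_continuous. now apply schwartz_ex_derive. Qed.

Lemma schwartz_Derive (u : R -> R) : schwartz_R u -> schwartz_R (Derive u).
Proof.
  intros [H1 H2].
  assert (E : forall n x, Derive_n (Derive u) n x = Derive_n u (S n) x).
  { intros n x. rewrite <- Nat.add_1_r. exact (Derive_n_comp u n 1 x). }
  split.
  - intros [|n] x; [exact I|]. simpl.
    apply (ex_derive_ext (Derive_n u (S n))); [intros; now rewrite E|].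
    exact (H1 (S (S n)) x).
  - intros k n. destruct (H2 k (S n)) as [M HM]. exists M. intros x. now rewrite E.
Qed.

Lemma schwartz_plus (u v : R -> R) :
  schwartz_R u -> schwartz_R v -> schwartz_R (fun x => u x + v x).
Proof.
  intros [H1 H2] [K1 K2].
  assert (E : forall n x, Derive_n (fun x => u x + v x) n x = Derive_n u n x + Derive_n v n x).
  { intros n x. apply Derive_n_plus; apply filter_forall; auto. }
  split.
  - intros n x. apply ex_derive_n_plus; apply filter_forall; auto.
  - intros k n. destruct (H2 k n) as [M HM]. destruct (K2 k n) as [N HN].
    exists (M + N). intros x. rewrite E, Rmult_plus_distr_l.
    eapply Rle_trans; [apply Rabs_triang|]. specialize (HM x). specialize (HN x). lra.
Qed.

Lemma schwartz_opp (u : R -> R) : schwartz_R u -> schwartz_R (fun x => - u x).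
Proof.
  intros [K1 K2]. split.
  - intros n x. now apply ex_derive_n_opp.
  - intros k n. destruct (K2 k n) as [N HN]. exists N. intros x.
    rewrite Derive_n_opp, Ropp_mult_distr_r_reverse, Rabs_Ropp. apply HN.
Qed.

Lemma schwartz_minus (u v : R -> R) :
  schwartz_R u -> schwartz_R v -> schwartz_R (fun x => u x - v x).
Proof. intros Hu Hv. apply (schwartz_plus u (fun x => - v x)); auto using schwartz_opp. Qed.

Lemma schwartz_comp_opp (u : R -> R) : schwartz_R u -> schwartz_R (fun x => u (- x)).
Proof.
  intros [H1 H2]. split.
  - intros n x. apply ex_derive_n_comp_opp. apply filter_forall; auto.
  - intros k n. destruct (H2 k n) as [M HM]. exists M. intros x.
    rewrite Derive_n_comp_opp by (apply filter_forall; auto).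
    specialize (HM (- x)). revert HM. rewrite !Rabs_mult, <- !RPow_abs, Rabs_Ropp.
    replace (Rabs (-1)) with 1 by (rewrite Rabs_left; lra). rewrite pow1. lra.
Qed.

(** The seminorms with powers 0 and 4 suffice, because (1 + x^2)^2 <= 2 + 2 x^4. *)
Lemma schwartz_decay (u : R -> R) :
  schwartz_R u -> exists M, forall x, Rabs (u x) <= M / (1 + x ^ 2) ^ 2.
Proof.
  intros [_ H]. destruct (H 0%nat 0%nat) as [M0 H0]. destruct (H 4%nat 0%nat) as [M4 H4].
  exists (2 * M0 + 2 * M4). intros x. specialize (H0 x). specialize (H4 x).
  cbn [Derive_n] in H0, H4. rewrite Rabs_mult in H0, H4.
  rewrite (Rabs_pos_eq (x ^ 0)) in H0 by (simpl; lra). simpl (x ^ 0) in H0.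
  rewrite (Rabs_pos_eq (x ^ 4)) in H4 by nra.
  pose proof (Rabs_pos (u x)).
  assert (0 < (1 + x ^ 2) ^ 2) by nra.
  apply Rmult_le_reg_r with ((1 + x ^ 2) ^ 2); auto.
  replace ((2 * M0 + 2 * M4) / (1 + x ^ 2) ^ 2 * (1 + x ^ 2) ^ 2) with (2 * M0 + 2 * M4)
    by (field; nra).
  assert ((1 + x ^ 2) ^ 2 <= 2 + 2 * x ^ 4) by (pose proof (pow2_ge_0 (x ^ 2 - 1)); nra).
  nra.
Qed.

Lemma schwartz_fast (u : R -> R) : schwartz_R u -> fast u.
Proof.
  intros H. destruct (schwartz_decay u H) as [M HM]. exists M. intros x _. split; auto.
  now apply schwartz_continuous.
Qed.

Lemma schwartz_bounded (u : R -> R) :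
  schwartz_R u -> exists M, 0 <= M /\ forall x, Rabs (u x) <= M.
Proof.
  intros [_ H]. destruct (H 0%nat 0%nat) as [M0 H0].
  assert (Hb : forall x, Rabs (u x) <= M0).
  { intros x. specialize (H0 x). cbn [Derive_n] in H0. now rewrite pow_O, Rmult_1_l in H0. }
  exists M0. split; auto.
  eapply Rle_trans; [apply Rabs_pos|apply (Hb 0)].
Qed.

Lemma filterlim_inv_p_infty : filterlim Rinv (Rbar_locally p_infty) (locally 0).
Proof. apply (filterlim_Rbar_inv p_infty). discriminate. Qed.

Lemma schwartz_lim_p_infty (u : R -> R) :
  schwartz_R u -> filterlim u (Rbar_locally p_infty) (locally 0).
Proof.
  intros [_ H]. destruct (H 1%nat 0%nat) as [M HM].
  apply (filterlim_squeeze _ _ (fun x => scal M (/ x))).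
  - exists 0. intros x Hx. specialize (HM x). cbn [Derive_n] in HM.
    rewrite pow_1, Rabs_mult, (Rabs_pos_eq x) in HM by lra.
    rewrite Rminus_0_r. unfold scal; simpl; unfold mult; simpl.
    apply Rmult_le_reg_l with x; auto.
    replace (x * (M * / x)) with M by (field; lra). exact HM.
  - replace 0 with (scal M 0) by (unfold scal; simpl; unfold mult; simpl; ring).
    eapply filterlim_comp; [apply filterlim_inv_p_infty|apply (filterlim_scal_r M 0)].
Qed.

Lemma is_derive_Derive (u : R -> R) (x : R) : schwartz_R u -> is_derive u x (Derive u x).
Proof. intros H. apply Derive_correct. now apply schwartz_ex_derive. Qed.

Lemma Derive_odd (f : R -> R) :
  schwartz_R f -> (forall x, f (- x) = - f x) -> forall x, Derive f (- x) = Derive f x.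
Proof.
  intros H Ho x.
  assert (H1 : is_derive (fun y => - f (- y)) x (Derive f (- x))).
  { auto_derive; [now apply schwartz_ex_derive|].
    change (fun x => f x) with f. ring. }
  rewrite <- (is_derive_unique _ _ _ H1). apply Derive_ext. intros t. rewrite Ho. ring.
Qed.

Lemma Derive_even (f : R -> R) :
  schwartz_R f -> (forall x, f (- x) = f x) -> forall x, Derive f (- x) = - Derive f x.
Proof.
  intros H Ho x.
  assert (H1 : is_derive (fun y => f (- y)) x (- Derive f (- x))).
  { auto_derive; [now apply schwartz_ex_derive|].
    change (fun x => f x) with f. ring. }
  replace (Derive f x) with (- Derive f (- x)); [ring|].
  rewrite <- (is_derive_unique _ _ _ H1). apply Derive_ext. exact Ho.
Qed.

Lemma odd_0 (f : R -> R) : (forall x, f (- x) = - f x) -> f 0 = 0.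
Proof. intros H. specialize (H 0). rewrite Ropp_0 in H. lra. Qed.

(** Two integrations by parts, packed into one primitive F. Its boundary value at 0 is - k f(0) sin
    theta + f'(0) cos theta, which explains the two hypotheses. *)
Lemma trig_transform_Derive2 (theta k : R) (f : R -> R) :
  schwartz_R f -> f 0 * sin theta = 0 -> Derive f 0 * cos theta = 0 ->
  k ^ 2 * trig_transform theta f k = - trig_transform theta (Derive (Derive f)) k.
Proof.
  intros Hf B0 B1.
  pose proof (schwartz_Derive f Hf) as Hf1. pose proof (schwartz_Derive _ Hf1) as Hf2.
  pose proof (schwartz_fast _ Hf) as Ff. pose proof (schwartz_fast _ Hf2) as Ff2.
  set (F := fun x => k * f x * sin (k * x - theta) + Derive f x * cos (k * x - theta)).
  set (g := fun x => k ^ 2 * (f x * cos (k * x - theta))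
                   + Derive (Derive f) x * cos (k * x - theta)).
  assert (HF : forall x, is_derive F x (g x)).
  { intros x. unfold F, g. auto_derive.
    - repeat split; now apply schwartz_ex_derive.
    - change (fun x => f x) with f. change (fun x => Derive f x) with (Derive f).
      unfold Rminus. ring. }
  assert (E : half_int g = 0 - 0).
  { apply (half_int_derive F); auto.
    - intros x _. unfold g.
      assert (Hc : continuous (fun x => cos (k * x - theta)) x)
        by (apply @ex_derive_continuous; auto_derive; exact I).
      apply (continuous_plus (fun x => k ^ 2 * (f x * cos (k * x - theta)))).
      + apply (continuous_scal_r (k ^ 2) (fun x => f x * cos (k * x - theta))).
        apply (continuous_mult f); auto using schwartz_continuous.
      + apply (continuous_mult (Derive (Derive f))); auto using schwartz_continuous.
    - replace 0 with (F 0) at 2.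
      + apply filterlim_at_right_0. apply @ex_derive_continuous. now exists (g 0).
      + unfold F. rewrite Rmult_0_r, Rminus_0_l, sin_neg, cos_neg, B1.
        replace (k * f 0 * - sin theta) with (- k * (f 0 * sin theta)) by ring.
        rewrite B0. ring.
    - apply (filterlim_squeeze _ _ (fun x => Rabs k * Rabs (f x) + Rabs (Derive f x))).
      + exists 0. intros x _. rewrite Rminus_0_r. unfold F.
        eapply Rle_trans; [apply Rabs_triang|]. rewrite !Rabs_mult.
        pose proof (Rabs_sin_le_1 (k * x - theta)). pose proof (Rabs_cos_le_1 (k * x - theta)).
        pose proof (Rmult_le_pos _ _ (Rabs_pos k) (Rabs_pos (f x))).
        pose proof (Rabs_pos (Derive f x)). nra.
      + assert (Habs : forall u : R -> R, schwartz_R u ->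
            filterlim (fun x => Rabs (u x)) (Rbar_locally p_infty) (locally 0)).
        { intros u Hu. rewrite <- Rabs_R0.
          eapply filterlim_comp; [now apply schwartz_lim_p_infty|apply continuous_Rabs]. }
        replace (locally 0) with (locally (plus (scal (Rabs k) 0) 0)).
        2: f_equal; unfold plus, scal; simpl; unfold mult; simpl; ring.
        eapply (filterlim_comp_2 (fun x => scal (Rabs k) (Rabs (f x))) (fun x => Rabs (Derive f x)) plus).
        * eapply filterlim_comp; [apply (Habs f Hf)|apply (filterlim_scal_r (Rabs k) 0)].
        * apply (Habs _ Hf1).
        * apply (filterlim_plus (scal (Rabs k) 0) 0). }
  unfold g in E. rewrite half_int_plus, half_int_scal in E;
    auto using admissible_scal, trig_admissible.
  unfold trig_transform. lra.
Qed.

(** Applying the previous identity to f and to f'' gives (1 + k^2)^2 T(f) = T(f) - 2 T(f'') +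
    T(f''''), and each transform on the right is bounded. The four conditions are the boundary terms
    of the two applications. *)
Lemma trig_transform_decay (theta : R) (f : R -> R) :
  schwartz_R f -> f 0 * sin theta = 0 -> Derive f 0 * cos theta = 0 ->
  Derive (Derive f) 0 * sin theta = 0 -> Derive (Derive (Derive f)) 0 * cos theta = 0 ->
  exists M, forall k, Rabs (trig_transform theta f k) <= M / (1 + k ^ 2) ^ 2.
Proof.
  intros Hf B0 B1 B2 B3.
  pose proof (schwartz_Derive f Hf) as Hf1. pose proof (schwartz_Derive _ Hf1) as Hf2.
  pose proof (schwartz_Derive _ Hf2) as Hf3. pose proof (schwartz_Derive _ Hf3) as Hf4.
  set (N := fun u : R -> R => half_int (fun x => Rabs (u x) * (1 * (1 + x ^ 2)))).
  exists (N f + 2 * N (Derive (Derive f)) + N (Derive (Derive (Derive (Derive f))))).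
  intros k.
  pose proof (trig_transform_bounded theta k f (schwartz_fast _ Hf)) as T0.
  pose proof (trig_transform_bounded theta k _ (schwartz_fast _ Hf2)) as T2.
  pose proof (trig_transform_bounded theta k _ (schwartz_fast _ Hf4)) as T4.
  pose proof (trig_transform_Derive2 theta k f Hf B0 B1) as E1.
  pose proof (trig_transform_Derive2 theta k _ Hf2 B2 B3) as E2.
  fold (N f) in T0. fold (N (Derive (Derive f))) in T2.
  fold (N (Derive (Derive (Derive (Derive f))))) in T4.
  assert (0 < (1 + k ^ 2) ^ 2) by nra.
  apply Rmult_le_reg_r with ((1 + k ^ 2) ^ 2); auto.
  match goal with |- _ <= ?A / ?B * ?B => replace (A / B * B) with A by (field; nra) end.
  rewrite <- (Rabs_pos_eq ((1 + k ^ 2) ^ 2)) at 1 by lra.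
  rewrite <- Rabs_mult.
  replace (trig_transform theta f k * (1 + k ^ 2) ^ 2)
    with (trig_transform theta f k + (2 * (k ^ 2 * trig_transform theta f k)
          + k ^ 2 * (k ^ 2 * trig_transform theta f k))) by ring.
  rewrite E1.
  replace (k ^ 2 * - trig_transform theta (Derive (Derive f)) k)
    with (- (k ^ 2 * trig_transform theta (Derive (Derive f)) k)) by ring.
  rewrite E2, Ropp_involutive.
  eapply Rle_trans; [apply Rabs_triang|].
  rewrite Rplus_assoc. apply Rplus_le_compat; auto.
  eapply Rle_trans; [apply Rabs_triang|].
  apply Rplus_le_compat; auto.
  rewrite Rabs_mult, Rabs_Ropp, (Rabs_pos_eq 2) by lra. lra.
Qed.

Lemma trig_transform_fast (theta : R) (f : R -> R) :
  schwartz_R f -> f 0 * sin theta = 0 -> Derive f 0 * cos theta = 0 ->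
  Derive (Derive f) 0 * sin theta = 0 -> Derive (Derive (Derive f)) 0 * cos theta = 0 ->
  fast (trig_transform theta f).
Proof.
  intros Hf B0 B1 B2 B3. destruct (trig_transform_decay theta f Hf B0 B1 B2 B3) as [M HM].
  exists M. intros k _. split; auto.
  apply @ex_derive_continuous. apply ex_derive_trig_transform. now apply schwartz_fast.
Qed.

(** Two boundary conditions hold because sin 0 = 0, the other two because f' and f''' are odd. The
    sine transform of an odd function is dual: cos(PI / 2) = 0 and f, f'' are odd. *)
Lemma cos_transform_fast (f : R -> R) :
  schwartz_R f -> (forall x, f (- x) = f x) -> fast (trig_transform 0 f).
Proof.
  intros Hf He.
  pose proof (schwartz_Derive f Hf) as Hf1. pose proof (schwartz_Derive _ Hf1) as Hf2.
  assert (O1 := Derive_even f Hf He). assert (E2 := Derive_odd _ Hf1 O1).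
  assert (O3 := Derive_even _ Hf2 E2).
  apply trig_transform_fast; auto; rewrite ?sin_0, ?(odd_0 _ O1), ?(odd_0 _ O3); ring.
Qed.

Lemma sin_transform_fast (f : R -> R) :
  schwartz_R f -> (forall x, f (- x) = - f x) -> fast (trig_transform (PI / 2) f).
Proof.
  intros Hf Ho.
  pose proof (schwartz_Derive f Hf) as Hf1.
  assert (E1 := Derive_odd f Hf Ho). assert (O2 := Derive_even _ Hf1 E1).
  apply trig_transform_fast; auto; rewrite ?cos_PI2, ?(odd_0 _ Ho), ?(odd_0 _ O2); ring.
Qed.

(** Fourth order decay and a first order zero at 0 in a single bound, the property that tolerates a
    kernel with a simple pole. *)
Definition vanishing (f : R -> R) : Prop :=
  exists M, 0 <= M /\ forall x, 0 < x -> Rabs (f x) <= M * x / (1 + x ^ 2) ^ 2.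

Lemma fast_vanishing (f : R -> R) (C : R) :
  fast f -> (forall x, 0 < x -> Rabs (f x) <= C * x) -> vanishing f.
Proof.
  (* For x <= 1 the linear bound is used with (1 + x^2)^2 <= 4; for x > 1 the decay is used with M
     <= |M| x. *)
  intros [M HM] HC. exists (4 * Rabs C + Rabs M). split.
  { pose proof (Rabs_pos C). pose proof (Rabs_pos M). lra. }
  intros x Hx. destruct (HM x Hx) as [_ H1]. specialize (HC x Hx).
  pose proof (Rle_abs C). pose proof (Rle_abs M). pose proof (Rabs_pos C). pose proof (Rabs_pos M).
  pose proof (Rabs_pos (f x)).
  assert (Hp : 0 < (1 + x ^ 2) ^ 2) by nra.
  apply Rmult_le_reg_r with ((1 + x ^ 2) ^ 2); auto.
  match goal with |- _ <= ?A / ?B * ?B => replace (A / B * B) with A by (field; nra) end.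
  assert (HfM : Rabs (f x) * (1 + x ^ 2) ^ 2 <= M).
  { apply Rmult_le_compat_r with (r := (1 + x ^ 2) ^ 2) in H1; [|lra].
    replace (M / (1 + x ^ 2) ^ 2 * (1 + x ^ 2) ^ 2) with M in H1 by (field; nra). exact H1. }
  destruct (Rle_dec x 1).
  - assert ((1 + x ^ 2) ^ 2 <= 4).
    { assert (1 + x ^ 2 <= 2) by nra. nra. }
    apply Rle_trans with (C * x * 4); [apply Rmult_le_compat; lra|]. nra.
  - nra.
Qed.

Lemma odd_schwartz_vanishing (f : R -> R) :
  schwartz_R f -> (forall x, f (- x) = - f x) -> vanishing f.
Proof.
  intros Hf Ho. destruct (schwartz_bounded _ (schwartz_Derive _ Hf)) as [M [HM0 HM]].
  apply fast_vanishing with M; [now apply schwartz_fast|].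
  intros x Hx. destruct (mean_value f (Derive f) 0 x) as [c [_ E]].
  { intros; now apply is_derive_Derive. }
  rewrite (odd_0 f Ho), !Rminus_0_r in E. rewrite E, Rabs_mult, (Rabs_pos_eq x) by lra.
  apply Rmult_le_compat_r; [lra|apply HM].
Qed.

Lemma sin_transform_vanishing (f : R -> R) :
  schwartz_R f -> (forall x, f (- x) = - f x) -> vanishing (trig_transform (PI / 2) f).
Proof.
  intros Hf Ho.
  apply fast_vanishing with (half_int (fun x => Rabs (f x) * (1 * (1 + x ^ 2)))).
  - now apply sin_transform_fast.
  - intros k Hk. rewrite Rmult_comm. apply trig_transform_small; auto using schwartz_fast.
Qed.

Lemma vanishing_mult (f g : R -> R) (C : R) :
  0 <= C -> vanishing f -> (forall x, 0 < x -> continuous f x) ->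
  (forall x, 0 < x -> continuous g x) ->
  (forall x, 0 < x -> Rabs (g x) <= C * (1 + / x)) ->
  admissible (fun x => f x * g x).
Proof.
  intros HC0 [M [HM HfM]] Hf Hg HC. exists (2 * M * C). intros x Hx. split.
  { apply (continuous_mult f g); auto. }
  rewrite Rabs_mult.
  assert (Hp : 0 < 1 + x ^ 2) by nra.
  apply Rle_trans with (M * x / (1 + x ^ 2) ^ 2 * (C * (1 + / x))).
  - apply Rmult_le_compat; auto using Rabs_pos.
  - replace (M * x / (1 + x ^ 2) ^ 2 * (C * (1 + / x)))
      with (M * C * (x + 1) / (1 + x ^ 2) ^ 2) by (field; split; nra).
    replace (2 * M * C / (1 + x ^ 2)) with (M * C * (2 * (1 + x ^ 2)) / (1 + x ^ 2) ^ 2) by (field; nra).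
    apply Rmult_le_compat_r; [apply Rlt_le, Rinv_0_lt_compat; nra|].
    apply Rmult_le_compat_l; [now apply Rmult_le_pos|nra].
Qed.

(** * Poisson kernels and the total integrals of the cosine and sine transforms *)

Lemma lorentz_le (a x : R) : 0 < a -> a / (a ^ 2 + x ^ 2) <= (a + / a) / (1 + x ^ 2).
Proof.
  intros Ha. pose proof (sum_sqr_pos a x Ha) as H1. pose proof (one_plus_sqr_pos x) as H2.
  apply Rmult_le_reg_r with (a ^ 2 + x ^ 2); auto.
  apply Rmult_le_reg_r with (1 + x ^ 2); auto.
  replace (a / (a ^ 2 + x ^ 2) * (a ^ 2 + x ^ 2) * (1 + x ^ 2)) with (a * (1 + x ^ 2)) by (field; lra).
  replace ((a + / a) / (1 + x ^ 2) * (a ^ 2 + x ^ 2) * (1 + x ^ 2))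
    with (a + a * x ^ 2 + a ^ 3 + / a * x ^ 2) by (field; split; nra).
  pose proof (Rinv_0_lt_compat a Ha). pose proof (pow_lt a 3 Ha).
  assert (0 <= / a * x ^ 2) by (apply Rmult_le_pos; [lra|apply pow2_ge_0]). lra.
Qed.

Lemma lorentz_kernel_admissible (a : R) : 0 < a -> admissible (fun x => a / (a ^ 2 + x ^ 2)).
Proof.
  intros Ha. exists (a + / a). intros x Hx. pose proof (sum_sqr_pos a x Ha) as H1. split.
  - apply @ex_derive_continuous. auto_derive. simpl in *; lra.
  - rewrite Rabs_pos_eq; [now apply lorentz_le|].
    apply Rlt_le, Rdiv_lt_0_compat; auto.
Qed.

Lemma half_int_lorentz (a : R) : 0 < a -> half_int (fun x => a / (a ^ 2 + x ^ 2)) = PI / 2.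
Proof.
  intros Ha. rewrite (half_int_derive (fun x => atan (x / a)) _ 0 (PI / 2)).
  - ring.
  - intros x Hx. pose proof (sum_sqr_pos a x Ha).
    replace (a / (a ^ 2 + x ^ 2)) with (scal (/ a) (/ (1 + (x / a)²))).
    + apply (is_derive_comp atan (fun x => x / a) x); [apply is_derive_atan|].
      auto_derive; [exact I|]. field; lra.
    + unfold scal; simpl; unfold mult; simpl. unfold Rsqr. field. repeat split; nra.
  - intros x Hx. pose proof (sum_sqr_pos a x Ha).
    apply @ex_derive_continuous. auto_derive. simpl in *; lra.
  - replace 0 with ((fun x => atan (x / a)) 0) at 2.
    + apply filterlim_at_right_0. apply @ex_derive_continuous. auto_derive. exact I.
    + unfold Rdiv. now rewrite Rmult_0_l, atan_0.
  - eapply filterlim_comp; [|apply filterlim_atan_p_infty].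
    intros P [m HP]. exists (a * m). intros x Hx. apply HP.
    apply Rmult_lt_reg_l with a; auto. replace (a * (x / a)) with x by (field; lra). exact Hx.
Qed.

(** This takes the place of limits: a will be a damping parameter, or a bound for 1 / N. *)
Lemma eq_of_linear_bound (x y C : R) :
  (forall a, 0 < a <= 1 -> Rabs (x - y) <= C * a) -> x = y.
Proof.
  intros H. destruct (Req_dec x y) as [E|E]; auto. exfalso.
  assert (Hp : 0 < Rabs (x - y)) by (apply Rabs_pos_lt; lra).
  assert (HC : 0 < C) by (specialize (H 1); lra).
  set (a := Rmin 1 (Rabs (x - y) / (2 * C))).
  assert (Ha : 0 < a <= 1).
  { split; [|apply Rmin_l]. apply Rmin_glb_lt; [lra|]. apply Rdiv_lt_0_compat; lra. }
  specialize (H a Ha).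
  assert (H2 : a <= Rabs (x - y) / (2 * C)) by apply Rmin_r.
  apply Rmult_le_compat_l with (r := C) in H2; [|lra].
  replace (C * (Rabs (x - y) / (2 * C))) with (Rabs (x - y) / 2) in H2 by (field; lra). lra.
Qed.

Lemma one_minus_exp_bound (y : R) : 0 <= y -> Rabs (1 - exp (- y)) <= y.
Proof.
  intros Hy. pose proof (exp_ineq1_le (- y)).
  assert (exp (- y) <= 1).
  { rewrite <- exp_0. destruct (Req_dec y 0) as [->|]; [rewrite Ropp_0; lra|].
    left; apply exp_increasing; lra. }
  rewrite Rabs_pos_eq; lra.
Qed.

(** Abel damping costs O(a), since 0 <= 1 - e^(- a k) <= a k <= a (1 + k^2). *)
Lemma half_int_exp_damping (T : R -> R) (a : R) :
  fast T -> 0 < a ->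
  admissible (fun k => exp (- a * k) * T k) /\
  Rabs (half_int T - half_int (fun k => exp (- a * k) * T k)) <=
    half_int (fun x => Rabs (T x) * (1 * (1 + x ^ 2))) * a.
Proof.
  intros HT Ha.
  assert (A1 : admissible (fun k => T k * (1 - exp (- a * k)))).
  { apply (fast_mult T (fun k => 1 - exp (- a * k)) a); auto.
    - intros. apply @ex_derive_continuous. auto_derive. exact I.
    - intros x Hx. rewrite Ropp_mult_distr_l_reverse.
      eapply Rle_trans; [apply one_minus_exp_bound; nra|].
      apply Rmult_le_compat_l; nra. }
  assert (A2 : admissible (fun k => exp (- a * k) * T k)).
  { apply (admissible_ext (fun k => T k - T k * (1 - exp (- a * k)))); [intros; ring|].
    apply admissible_minus; auto using fast_admissible. }
  split; auto.
  rewrite <- half_int_minus by auto using fast_admissible.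
  rewrite (half_int_ext _ (fun k => T k * (1 - exp (- a * k)))).
  - rewrite Rmult_comm. apply half_int_weight_bound; auto.
    intros x Hx. rewrite Ropp_mult_distr_l_reverse.
    eapply Rle_trans; [apply one_minus_exp_bound; nra|].
    apply Rmult_le_compat_l; nra.
  - intros; ring.
  - auto using admissible_minus, fast_admissible.
Qed.

(** Since f'(0) = 0, f - f(0) is at most M2 x^2 near 0, and at most 2 M0 everywhere. The denominator
    1 + x^2 merges the two bounds, splitting at x = 1. *)
Lemma even_schwartz_quadratic (f : R -> R) :
  schwartz_R f -> (forall x, f (- x) = f x) ->
  exists C, 0 <= C /\ forall x, 0 < x -> Rabs (f x - f 0) <= C * x ^ 2 / (1 + x ^ 2).
Proof.
  intros Hf He. pose proof (schwartz_Derive f Hf) as Hf1. pose proof (schwartz_Derive _ Hf1) as Hf2.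
  assert (O1 := Derive_even f Hf He).
  destruct (schwartz_bounded f Hf) as [M0 [P0 HM0]].
  destruct (schwartz_bounded _ Hf2) as [M2 [P2 HM2]].
  exists (2 * M2 + 4 * M0). split; [lra|]. intros x Hx.
  assert (Hq : Rabs (f x - f 0) <= M2 * x ^ 2).
  { destruct (mean_value f (Derive f) 0 x) as [c [Hc E]].
    { intros; now apply is_derive_Derive. }
    destruct (mean_value (Derive f) (Derive (Derive f)) 0 c) as [d [_ E2]].
    { intros; now apply is_derive_Derive. }
    rewrite (odd_0 _ O1), !Rminus_0_r in E2. rewrite Rminus_0_r in E. rewrite !Rminus_0_r in Hc.
    rewrite E, E2, !Rabs_mult. rewrite (Rabs_pos_eq x) in Hc by lra. rewrite (Rabs_pos_eq x) by lra.
    specialize (HM2 d). pose proof (Rabs_pos c). pose proof (Rabs_pos (Derive (Derive f) d)).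
    assert (Rabs (Derive (Derive f) d) * Rabs c <= M2 * x) by (apply Rmult_le_compat; lra).
    nra. }
  assert (Hb : Rabs (f x - f 0) <= 2 * M0).
  { eapply Rle_trans; [apply Rabs_triang|]. rewrite Rabs_Ropp.
    pose proof (HM0 x). pose proof (HM0 0). lra. }
  apply Rmult_le_reg_r with (1 + x ^ 2); [nra|].
  match goal with |- _ <= ?A / ?B * ?B => replace (A / B * B) with A by (field; nra) end.
  pose proof (Rmult_le_pos _ _ P0 (pow2_ge_0 x)). pose proof (Rmult_le_pos _ _ P2 (pow2_ge_0 x)).
  destruct (Rle_dec x 1).
  - apply Rle_trans with (M2 * x ^ 2 * 2); [apply Rmult_le_compat; try nra; apply Rabs_pos|lra].
  - apply Rle_trans with (2 * M0 * (2 * x ^ 2)); [apply Rmult_le_compat; try nra; apply Rabs_pos|lra].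
Qed.

(** Fourier inversion at the origin. With damping a the left side becomes the Poisson integral of f,
    and the Poisson kernel has mass PI / 2. Against the quadratic bound for f - f(0) its factor x^2
    / (a^2 + x^2) is at most 1, so the error is at most C a times the integral of 1 / (1 + x^2). *)
Lemma half_int_cos_transform (f : R -> R) :
  schwartz_R f -> (forall x, f (- x) = f x) ->
  half_int (trig_transform 0 f) = PI / 2 * f 0.
Proof.
  intros Hf He.
  pose proof (cos_transform_fast f Hf He) as HT.
  pose proof (schwartz_fast f Hf) as Ff.
  destruct (even_schwartz_quadratic f Hf He) as [C [HC0 HC]].
  set (K := half_int (fun x => Rabs (trig_transform 0 f x) * (1 * (1 + x ^ 2)))).
  apply eq_of_linear_bound with (K + C * (PI / 2)). intros a [Ha Ha1].
  destruct (half_int_exp_damping _ a HT Ha) as [_ B1]. fold K in B1.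
  rewrite (half_int_laplace_trig_transform a 0 f Ha Ff) in B1.
  assert (AL : admissible (fun x => f x * ((x * sin 0 + a * cos 0) / (a ^ 2 + x ^ 2))))
    by now apply lorentz_admissible.
  rewrite <- (half_int_lorentz a Ha) at 1. rewrite (Rmult_comm _ (f 0)), <- half_int_scal
    by now apply lorentz_kernel_admissible.
  assert (B2 : Rabs (half_int (fun x => f x * ((x * sin 0 + a * cos 0) / (a ^ 2 + x ^ 2)))
                 - half_int (fun x => f 0 * (a / (a ^ 2 + x ^ 2)))) <= C * (PI / 2) * a).
  { rewrite <- half_int_minus
      by auto using admissible_scal, lorentz_kernel_admissible.
    rewrite <- (half_int_lorentz 1 Rlt_0_1).
    replace (C * half_int (fun x => 1 / (1 ^ 2 + x ^ 2)) * a)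
      with (C * a * half_int (fun x => 1 / (1 ^ 2 + x ^ 2))) by ring.
    rewrite <- half_int_scal by (apply lorentz_kernel_admissible; lra).
    apply half_int_abs_le.
    - auto using admissible_minus, admissible_scal, lorentz_kernel_admissible.
    - apply admissible_scal, lorentz_kernel_admissible; lra.
    - intros x Hx. rewrite sin_0, cos_0. pose proof (sum_sqr_pos a x Ha) as Hp.
      replace (f x * ((x * 0 + a * 1) / (a ^ 2 + x ^ 2)) - f 0 * (a / (a ^ 2 + x ^ 2)))
        with ((f x - f 0) * (a / (a ^ 2 + x ^ 2))) by (field; lra).
      rewrite Rabs_mult, (Rabs_pos_eq (a / _)) by (apply Rlt_le, Rdiv_lt_0_compat; lra).
      apply Rle_trans with (C * x ^ 2 / (1 + x ^ 2) * (a / (a ^ 2 + x ^ 2))).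
      { apply Rmult_le_compat_r; [apply Rlt_le, Rdiv_lt_0_compat; lra|auto]. }
      replace (C * x ^ 2 / (1 + x ^ 2) * (a / (a ^ 2 + x ^ 2)))
        with (C * a * (1 / (1 ^ 2 + x ^ 2)) * (x ^ 2 / (a ^ 2 + x ^ 2))) by (field; split; nra).
      rewrite <- (Rmult_1_r (C * a * (1 / (1 ^ 2 + x ^ 2)))) at 2.
      apply Rmult_le_compat_l.
      + apply Rmult_le_pos; [nra|]. apply Rlt_le, Rdiv_lt_0_compat; nra.
      + apply Rmult_le_reg_r with (a ^ 2 + x ^ 2); auto.
        replace (x ^ 2 / (a ^ 2 + x ^ 2) * (a ^ 2 + x ^ 2)) with (x ^ 2) by (field; lra). nra. }
  revert B1 B2.
  generalize (half_int (fun x => f x * ((x * sin 0 + a * cos 0) / (a ^ 2 + x ^ 2))))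
    (half_int (fun x => f 0 * (a / (a ^ 2 + x ^ 2)))).
  intros u v B1 B2.
  replace (half_int (trig_transform 0 f) - v) with ((half_int (trig_transform 0 f) - u) + (u - v)) by ring.
  eapply Rle_trans; [apply Rabs_triang|]. lra.
Qed.

Lemma half_int_laplace_sin_transform (a : R) (f : R -> R) :
  0 < a -> fast f ->
  half_int (fun k => exp (- a * k) * trig_transform (PI / 2) f k) =
  half_int (fun x => f x * (x / (a ^ 2 + x ^ 2))).
Proof.
  intros Ha Hf. rewrite half_int_laplace_trig_transform by auto.
  apply half_int_ext; [|now apply lorentz_admissible].
  intros x _. rewrite sin_PI2, cos_PI2. f_equal. f_equal. ring.
Qed.

Lemma conjugate_lorentz_admissible (a : R) (f : R -> R) :
  0 < a -> fast f -> admissible (fun x => f x * (x / (a ^ 2 + x ^ 2))).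
Proof.
  intros Ha Hf.
  apply (admissible_ext (fun x => f x * ((x * sin (PI / 2) + a * cos (PI / 2)) / (a ^ 2 + x ^ 2)))).
  - intros x _. rewrite sin_PI2, cos_PI2. f_equal. f_equal. ring.
  - now apply lorentz_admissible.
Qed.

Lemma continuous_Rinv_pos (x : R) : 0 < x -> continuous Rinv x.
Proof. intros Hx. apply @ex_derive_continuous. auto_derive. lra. Qed.

Lemma vanishing_inv_admissible (f : R -> R) :
  fast f -> vanishing f -> admissible (fun x => f x * / x).
Proof.
  intros [M Ff] Hv. apply vanishing_mult with 1; auto using continuous_Rinv_pos; [lra| |].
  - intros x Hx. now apply Ff.
  - intros x Hx. pose proof (Rinv_0_lt_compat x Hx). rewrite Rabs_pos_eq; lra.
Qed.

(** The term n = 0 of the expansion, where a = 0 is not allowed in the Laplace formula. The kernels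
    differ by 1 / x - x / (a^2 + x^2) = a^2 / (x (a^2 + x^2)); against |f| <= M x this leaves M a
    times the Poisson kernel. *)
Lemma half_int_sin_transform (f : R -> R) :
  schwartz_R f -> (forall x, f (- x) = - f x) ->
  half_int (trig_transform (PI / 2) f) = half_int (fun x => f x * / x).
Proof.
  intros Hf Ho.
  pose proof (sin_transform_fast f Hf Ho) as HT.
  pose proof (schwartz_fast f Hf) as Ff.
  pose proof (odd_schwartz_vanishing f Hf Ho) as Hv.
  assert (AI := vanishing_inv_admissible f Ff Hv).
  destruct Hv as [M [HM0 HM]].
  set (K := half_int (fun x => Rabs (trig_transform (PI / 2) f x) * (1 * (1 + x ^ 2)))).
  apply eq_of_linear_bound with (K + M * (PI / 2)). intros a [Ha Ha1].
  destruct (half_int_exp_damping _ a HT Ha) as [_ B1]. fold K in B1.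
  rewrite (half_int_laplace_sin_transform a f Ha Ff) in B1.
  assert (AL := conjugate_lorentz_admissible a f Ha Ff).
  assert (B2 : Rabs (half_int (fun x => f x * (x / (a ^ 2 + x ^ 2)))
                 - half_int (fun x => f x * / x)) <= M * (PI / 2) * a).
  { rewrite <- half_int_minus by auto.
    rewrite <- (half_int_lorentz a Ha).
    replace (M * half_int (fun x => a / (a ^ 2 + x ^ 2)) * a)
      with (M * a * half_int (fun x => a / (a ^ 2 + x ^ 2))) by ring.
    rewrite <- half_int_scal by now apply lorentz_kernel_admissible.
    apply half_int_abs_le; auto using admissible_minus.
    - now apply admissible_scal, lorentz_kernel_admissible.
    - intros x Hx. pose proof (sum_sqr_pos a x Ha) as Hp.
      replace (f x * (x / (a ^ 2 + x ^ 2)) - f x * / x)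
        with (- (f x * (/ x * (a ^ 2 / (a ^ 2 + x ^ 2))))) by (field; lra).
      assert (Hq : 0 < / x * (a ^ 2 / (a ^ 2 + x ^ 2))).
      { apply Rmult_lt_0_compat; [now apply Rinv_0_lt_compat|]. apply Rdiv_lt_0_compat; nra. }
      rewrite Rabs_Ropp, Rabs_mult, (Rabs_pos_eq (/ x * _)) by lra.
      apply Rle_trans with (M * x * (/ x * (a ^ 2 / (a ^ 2 + x ^ 2)))).
      + apply Rmult_le_compat_r; [lra|]. eapply Rle_trans; [now apply HM|].
        assert (0 <= M * x) by nra. assert (1 <= (1 + x ^ 2) ^ 2) by nra.
        apply Rmult_le_reg_r with ((1 + x ^ 2) ^ 2); [lra|].
        replace (M * x / (1 + x ^ 2) ^ 2 * (1 + x ^ 2) ^ 2) with (M * x) by (field; nra). nra.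
      + right. field. lra. }
  revert B1 B2.
  generalize (half_int (fun x => f x * (x / (a ^ 2 + x ^ 2)))) (half_int (fun x => f x * / x)).
  intros u v B1 B2.
  replace (half_int (trig_transform (PI / 2) f) - v)
    with ((half_int (trig_transform (PI / 2) f) - u) + (u - v)) by ring.
  eapply Rle_trans; [apply Rabs_triang|]. lra.
Qed.

(** * Partial fractions of the hyperbolic cotangent *)

(* [c 0 + 2 * (c 1 + ... + c N)], the sum over [-N..N] of an even sequence. *)
Fixpoint even_sum (c : nat -> R) (N : nat) : R :=
  match N with
  | O => c O
  | S n => even_sum c n + 2 * c (S n)
  end.

Lemma even_sum_ext (c d : nat -> R) (N : nat) :
  (forall n, c n = d n) -> even_sum c N = even_sum d N.
Proof. intros H. induction N; simpl; now rewrite ?IHN, H. Qed.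

Lemma even_sum_scal (k : R) (c : nat -> R) (N : nat) :
  even_sum (fun n => k * c n) N = k * even_sum c N.
Proof. induction N; simpl; rewrite ?IHN; ring. Qed.

(** Telescoping of 2 cos(n t) sin(t / 2) = sin((n + 1/2) t) - sin((n - 1/2) t). The product form
    needs no condition on t. *)
Lemma dirichlet_kernel (N : nat) (t : R) :
  even_sum (fun n => cos (INR n * t)) N * sin (t / 2) = sin ((INR N + / 2) * t).
Proof.
  induction N.
  - simpl. rewrite Rmult_0_l, cos_0, Rmult_1_l. f_equal. field.
  - cbn [even_sum]. rewrite Rmult_plus_distr_r, IHN.
    replace ((INR (S N) + / 2) * t) with (INR (S N) * t + t / 2) by field.
    replace ((INR N + / 2) * t) with (INR (S N) * t - t / 2) by (rewrite S_INR; field).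
    rewrite sin_plus, sin_minus. ring.
Qed.

Lemma is_RInt_even_sum (h : R -> R) (c : nat -> R -> R) (I : nat -> R) (a b : R) (N : nat) :
  (forall n, is_RInt (fun t => h t * c n t) a b (I n)) ->
  is_RInt (fun t => h t * even_sum (fun n => c n t) N) a b (even_sum I N).
Proof.
  intros H. induction N as [|N IH]; [exact (H 0%nat)|]. cbn [even_sum].
  apply (is_RInt_ext (fun t => plus (h t * even_sum (fun n => c n t) N)
    (scal 2 (h t * c (S N) t)))).
  { intros t _. unfold plus, scal; simpl; unfold mult; simpl. ring. }
  apply @is_RInt_plus; [exact IH|]. apply @is_RInt_scal. apply H.
Qed.

Lemma sin_nat_PI (n : nat) : sin (INR n * PI) = 0.
Proof.
  induction n; [now rewrite Rmult_0_l, sin_0|].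
  rewrite S_INR, Rmult_plus_distr_r, Rmult_1_l, neg_sin, IHn. ring.
Qed.

Lemma derive_cosh_reflected (a t : R) :
  is_derive (fun t => cosh (a * (PI - t))) t (- a * sinh (a * (PI - t))).
Proof. unfold cosh, sinh. auto_derive; [exact I|]. unfold Rminus. field. Qed.

(** The reflected argument PI - t makes the primitive vanish at t = PI, where sinh 0 = 0 and sin(n
    PI) = 0; only the endpoint 0 contributes. *)
Lemma is_RInt_cosh_cos (a : R) (n : nat) : 0 < a ->
  is_RInt (fun t => cosh (a * (PI - t)) * cos (INR n * t)) 0 PI
    (a * sinh (a * PI) * / (a ^ 2 + INR n ^ 2)).
Proof.
  intros Ha. pose proof (sum_sqr_pos a (INR n) Ha) as Hp.
  set (F := fun t => (- a * sinh (a * (PI - t)) * cos (INR n * t)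
     + INR n * cosh (a * (PI - t)) * sin (INR n * t)) / (a ^ 2 + INR n ^ 2)).
  replace (a * sinh (a * PI) * / (a ^ 2 + INR n ^ 2)) with (minus (F PI) (F 0)).
  - apply (is_RInt_derive F).
    + intros t _. unfold F, cosh, sinh. auto_derive; [exact I|]. unfold Rminus, Rdiv. simpl in Hp.
      field. simpl. lra.
    + intros t _. apply @ex_derive_continuous. unfold cosh. auto_derive. exact I.
  - unfold F, minus, plus, opp; simpl. rewrite sin_nat_PI.
    rewrite !Rmult_0_r, Rminus_0_r, cos_0, sin_0, Rminus_diag_eq, Rmult_0_r, sinh_0 by reflexivity.
    field. simpl in Hp. lra.
Qed.

(** The factor 1 is the constant weight [h] in [is_RInt_even_sum]. *)
Lemma is_RInt_cos_nat (n : nat) :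
  is_RInt (fun t => 1 * cos (INR n * t)) 0 PI (if Nat.eqb n 0 then PI else 0).
Proof.
  destruct n as [|n].
  - apply (is_RInt_ext (fun _ => 1)).
    { intros t _. simpl. rewrite Rmult_0_l, cos_0. ring. }
    replace PI with (scal (PI - 0) 1) at 2 by (unfold scal; simpl; unfold mult; simpl; ring).
    apply @is_RInt_const.
  - assert (Hn : INR (S n) <> 0) by (apply not_0_INR; lia).
    pose proof (sin_nat_PI (S n)) as E. cbn [Nat.eqb]. revert Hn E. generalize (INR (S n)).
    intros m Hm E.
    replace 0 with (minus (sin (m * PI) / m) (sin (m * 0) / m)) at 2.
    + apply (is_RInt_derive (fun t => sin (m * t) / m)).
      * intros t _. auto_derive; [exact I|]. field. exact Hm.
      * intros t _. apply @ex_derive_continuous. auto_derive. exact I.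
    + rewrite E, Rmult_0_r, sin_0. unfold minus, plus, opp; simpl. field. exact Hm.
Qed.

Lemma even_sum_delta (N : nat) (p : R) :
  even_sum (fun n => if Nat.eqb n 0 then p else 0) N = p.
Proof. induction N; simpl; [reflexivity|]. rewrite IHN. ring. Qed.

(** The value on the right is the error of the partial fraction expansion, multiplied by sinh(a PI).
    Subtracting the value cosh(a PI) at t = 0 provides the zero that compensates sin(t / 2) in the
    Dirichlet kernel. *)
Lemma is_RInt_dirichlet_remainder (a : R) (N : nat) : 0 < a ->
  is_RInt (fun t => (cosh (a * (PI - t)) - cosh (a * PI)) *
                    even_sum (fun n => cos (INR n * t)) N) 0 PI
    (a * sinh (a * PI) * even_sum (fun n => / (a ^ 2 + INR n ^ 2)) N - PI * cosh (a * PI)).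
Proof.
  intros Ha.
  pose proof (is_RInt_even_sum _ _ _ 0 PI N (fun n => is_RInt_cosh_cos a n Ha)) as H1.
  pose proof (is_RInt_even_sum _ _ _ 0 PI N is_RInt_cos_nat) as H2.
  rewrite even_sum_delta in H2. rewrite even_sum_scal in H1.
  apply (is_RInt_scal _ _ _ (cosh (a * PI))) in H2.
  pose proof (is_RInt_minus _ _ _ _ _ _ H1 H2) as H3.
  replace (_ - PI * cosh (a * PI)) with
    (minus (a * sinh (a * PI) * even_sum (fun n => / (a ^ 2 + INR n ^ 2)) N)
       (scal (cosh (a * PI)) PI)).
  - eapply is_RInt_ext; [|exact H3]. intros t _.
    unfold minus, plus, opp, scal; simpl; unfold mult; simpl. ring.
  - unfold minus, plus, opp, scal; simpl; unfold mult; simpl. ring.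
Qed.

(** One integration by parts: the constant collects both boundary values and the integral of |q'|,
    and does not depend on the frequency. *)
Lemma riemann_lebesgue_C1 (q dq : R -> R) (a b : R) :
  a <= b -> (forall t, a <= t <= b -> is_derive q t (dq t)) ->
  (forall t, a <= t <= b -> continuous dq t) ->
  exists C, forall lam l, 0 < lam ->
    is_RInt (fun t => q t * sin (lam * t)) a b l -> Rabs l <= C / lam.
Proof.
  intros Hab Hq Hdq.
  assert (Hin : forall t, Rmin a b <= t <= Rmax a b -> a <= t <= b)
    by (intros t; rewrite Rmin_left, Rmax_right; auto).
  exists (Rabs (q b) + Rabs (q a) + RInt (fun t => Rabs (dq t)) a b).
  intros lam l Hlam Hl.
  assert (Hcos : forall t, continuous (fun t => cos (lam * t)) t)
    by (intros; apply @ex_derive_continuous; auto_derive; exact I).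
  assert (Hcont : forall t, a <= t <= b -> continuous (fun t => dq t * cos (lam * t)) t).
  { intros t Ht. apply (continuous_mult dq); auto. }
  assert (Ex : ex_RInt (fun t => dq t * cos (lam * t)) a b).
  { apply @ex_RInt_continuous. intros t Ht. apply Hcont. auto. }
  assert (Exa : ex_RInt (fun t => Rabs (dq t)) a b).
  { apply @ex_RInt_continuous. intros t Ht. apply (continuous_comp dq Rabs); auto.
    apply continuous_Rabs. }
  assert (Hv : Rabs (RInt (fun t => dq t * cos (lam * t)) a b) <= RInt (fun t => Rabs (dq t)) a b).
  { apply (norm_RInt_le (fun t => dq t * cos (lam * t)) (fun t => Rabs (dq t)) a b); auto.
    - intros t Ht. unfold norm; simpl; unfold abs; simpl. rewrite Rabs_mult.
      pose proof (Rabs_cos_le_1 (lam * t)). pose proof (Rabs_pos (dq t)). nra.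
    - apply (RInt_correct (V := R_CompleteNormedModule)); auto.
    - apply (RInt_correct (V := R_CompleteNormedModule)); auto. }
  set (F := fun t => - q t * cos (lam * t) / lam).
  assert (HF : is_RInt (fun t => minus (q t * sin (lam * t)) (scal (/ lam) (dq t * cos (lam * t))))
            a b (minus (F b) (F a))).
  { apply (is_RInt_derive F).
    - intros t Ht. unfold F. pose proof (Hq t (Hin t Ht)) as Hd. auto_derive.
      + now exists (dq t).
      + change (fun x => q x) with q. rewrite (is_derive_unique _ _ _ Hd).
        unfold minus, plus, opp, scal; simpl; unfold mult; simpl. field. lra.
    - intros t Ht. apply (continuous_minus (fun t => q t * sin (lam * t))).
      + apply (continuous_mult q).
        * apply @ex_derive_continuous. eexists. now apply Hq, Hin.
        * apply @ex_derive_continuous. auto_derive. exact I.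
      + apply (continuous_scal_r (/ lam) (fun t => dq t * cos (lam * t))). auto. }
  pose proof (is_RInt_scal _ _ _ (/ lam) _ (RInt_correct (V := R_CompleteNormedModule) _ _ _ Ex)) as Hs.
  pose proof (is_RInt_plus _ _ _ _ _ _ HF Hs) as Hsum.
  assert (El : l = plus (minus (F b) (F a)) (scal (/ lam) (RInt (fun t => dq t * cos (lam * t)) a b))).
  { etransitivity; [symmetry; exact (is_RInt_unique (V := R_CompleteNormedModule) _ _ _ _ Hl)|].
    etransitivity; [|exact (is_RInt_unique (V := R_CompleteNormedModule) _ _ _ _ Hsum)].
    apply (RInt_ext (V := R_CompleteNormedModule)). intros t _.
    unfold minus, plus, opp, scal; simpl; unfold mult; simpl. ring. }
  revert El Hv. unfold F, minus, plus, opp, scal; simpl; unfold mult; simpl.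
  generalize (RInt (fun t => dq t * cos (lam * t)) a b) (RInt (fun t => Rabs (dq t)) a b).
  intros v A El Hv. rewrite El.
  replace (- q b * cos (lam * b) / lam + - (- q a * cos (lam * a) / lam) + / lam * v)
    with ((- (q b * cos (lam * b)) + (q a * cos (lam * a) + v)) * / lam) by (field; lra).
  rewrite Rabs_mult, (Rabs_pos_eq (/ lam)) by (apply Rlt_le, Rinv_0_lt_compat; auto).
  apply Rmult_le_compat_r; [apply Rlt_le, Rinv_0_lt_compat; auto|].
  eapply Rle_trans; [apply Rabs_triang|].
  rewrite Rplus_assoc. apply Rplus_le_compat.
  - rewrite Rabs_Ropp, Rabs_mult. pose proof (Rabs_cos_le_1 (lam * b)). pose proof (Rabs_pos (q b)). nra.
  - eapply Rle_trans; [apply Rabs_triang|]. apply Rplus_le_compat; auto.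
    rewrite Rabs_mult. pose proof (Rabs_cos_le_1 (lam * a)). pose proof (Rabs_pos (q a)). nra.
Qed.

(** As 1 < PI / 3, the cosine is at least cos(PI / 3) = 1/2 on this range. *)
Lemma sin_ge_half (y : R) : 0 <= y <= 1 -> y / 2 <= sin y.
Proof.
  intros [Hy0 Hy1]. destruct (mean_value sin cos 0 y) as [c [Hc E]].
  { intros t. auto_derive; [exact I|ring]. }
  rewrite sin_0 in E. rewrite !Rminus_0_r in E. rewrite !Rminus_0_r in Hc. rewrite E.
  rewrite (Rabs_pos_eq y) in Hc by lra.
  assert (/ 2 <= cos c).
  { replace (/ 2) with (cos (PI / 3)) by (rewrite cos_PI3; lra).
    assert (Ec : cos c = cos (Rabs c)).
    { unfold Rabs. destruct (Rcase_abs c); [now rewrite cos_neg|reflexivity]. }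
    rewrite Ec. pose proof PI2_3_2. pose proof (Rabs_pos c).
    apply cos_decr_1; lra. }
  nra.
Qed.

Lemma abs_sinh_le (y b : R) : Rabs y <= b -> Rabs (sinh y) <= exp b.
Proof.
  intros Hy.
  assert (H : forall z, z <= b -> exp z <= exp b).
  { intros z [Hz|Hz]; [left; now apply exp_increasing|right; now rewrite Hz]. }
  assert (H1 : exp y <= exp b). { apply H. pose proof (Rle_abs y). lra. }
  assert (H2 : exp (- y) <= exp b).
  { apply H. pose proof (Rle_abs (- y)) as H2. rewrite Rabs_Ropp in H2. lra. }
  pose proof (exp_pos y). pose proof (exp_pos (- y)).
  unfold sinh. apply Rabs_le. lra.
Qed.

Lemma cosh_increment_bound (a t : R) : 0 < a -> 0 <= t <= PI ->
  Rabs (cosh (a * (PI - t)) - cosh (a * PI)) <= a * exp (a * (2 * PI)) * t.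
Proof.
  intros Ha [Ht0 Ht1].
  destruct (mean_value (fun t => cosh (a * (PI - t))) (fun t => - a * sinh (a * (PI - t))) 0 t)
    as [c [Hc E]].
  { apply derive_cosh_reflected. }
  rewrite !Rminus_0_r in E. rewrite E. rewrite !Rminus_0_r in Hc.
  rewrite (Rabs_pos_eq t) in Hc by lra.
  rewrite !Rabs_mult, Rabs_Ropp, (Rabs_pos_eq a), (Rabs_pos_eq t) by lra.
  (* The intermediate point is only known to satisfy |c| <= t <= PI, so |PI - c| <= 2 PI; this is
     the 2 PI in the constant. *)
  apply Rmult_le_compat_r; auto. apply Rmult_le_compat_l; [lra|].
  apply abs_sinh_le. rewrite Rabs_mult, (Rabs_pos_eq a) by lra.
  apply Rmult_le_compat_l; [lra|].
  assert (- t <= c <= t) by (unfold Rabs in Hc; destruct (Rcase_abs c); lra).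
  apply Rabs_le. lra.
Qed.

(** The integral is cut at a small d. On [0, d] the quotient q = h / sin(t / 2) is bounded, and the
    length d makes the piece small. On [d, PI] the quotient is smooth and the Riemann-Lebesgue bound
    applies, with a constant that depends on d but not on N. The removable singularity of q at 0 is
    thus never differentiated. *)
Lemma dirichlet_remainder_small (a eps : R) : 0 < a -> 0 < eps ->
  exists N0, forall N, (N0 <= N)%nat ->
    Rabs (a * sinh (a * PI) * even_sum (fun n => / (a ^ 2 + INR n ^ 2)) N - PI * cosh (a * PI))
    <= eps.
Proof.
  intros Ha Heps. pose proof PI2_3_2 as HPI.
  set (L := a * exp (a * (2 * PI))).
  assert (HL : 0 < L) by (apply Rmult_lt_0_compat; [lra|apply exp_pos]).
  (* From |h t| <= L t and sin(t / 2) >= t / 4 one gets |q| <= 4 L, so the first piece is at most 4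
     L d <= eps / 2. The bound 1 keeps t / 2 in the range of [sin_ge_half]. *)
  set (d := Rmin 1 (eps / (8 * L))).
  assert (Hd0 : 0 < d) by (apply Rmin_glb_lt; [lra|apply Rdiv_lt_0_compat; lra]).
  assert (Hd1 : d <= 1) by apply Rmin_l.
  assert (Hd2 : 4 * L * d <= eps / 2).
  { assert (H : d <= eps / (8 * L)) by apply Rmin_r.
    apply Rmult_le_compat_l with (r := 4 * L) in H; [|lra].
    replace (4 * L * (eps / (8 * L))) with (eps / 2) in H by (field; lra). exact H. }
  set (h := fun t => cosh (a * (PI - t)) - cosh (a * PI)).
  set (q := fun t => h t / sin (t / 2)).
  assert (Hsin : forall t, 0 < t <= PI -> 0 < sin (t / 2)) by (intros; apply sin_gt_0; lra).
  set (dq := fun t => (- a * sinh (a * (PI - t)) * sin (t / 2) - h t * (cos (t / 2) * / 2))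
                      / (sin (t / 2)) ^ 2).
  destruct (riemann_lebesgue_C1 q dq d PI) as [C HC].
  { lra. }
  { intros t Ht. assert (Hs := Hsin t). unfold q, dq, h, cosh, sinh. auto_derive.
    - lra.
    - unfold Rminus, Rdiv. field. unfold Rdiv in Hs; lra. }
  { intros t Ht. assert (Hs := Hsin t). apply @ex_derive_continuous.
    unfold dq, h, cosh, sinh. auto_derive. apply Rmult_integral_contrapositive_currified; lra. }
  destruct (archimed_cor1 (eps / (2 * (Rabs C + 1)))) as [N0 [HN0 HN0p]].
  { apply Rdiv_lt_0_compat; auto. pose proof (Rabs_pos C). lra. }
  exists N0. intros N HN.
  pose proof (is_RInt_dirichlet_remainder a N Ha) as HI.
  set (g := fun t => (cosh (a * (PI - t)) - cosh (a * PI)) * even_sum (fun n => cos (INR n * t)) N) in HI.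
  set (v := a * sinh (a * PI) * even_sum (fun n => / (a ^ 2 + INR n ^ 2)) N - PI * cosh (a * PI)) in *.
  assert (Ex : ex_RInt g 0 PI) by now exists v.
  assert (Ex1 : ex_RInt g 0 d)
    by (apply (ex_RInt_Chasles_1 (V := R_CompleteNormedModule) g 0 d PI); [lra|auto]).
  assert (Ex2 : ex_RInt g d PI)
    by (apply (ex_RInt_Chasles_2 (V := R_CompleteNormedModule) g 0 d PI); [lra|auto]).
  assert (Hgq : forall t, 0 < t <= PI -> g t = q t * sin ((INR N + / 2) * t)).
  { intros t Ht. unfold g, q, h. rewrite <- dirichlet_kernel. field. pose proof (Hsin t Ht). lra. }
  assert (B1 : Rabs (RInt g 0 d) <= (d - 0) * (4 * L)).
  { apply abs_RInt_le_const; auto; [lra|]. intros t Ht.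
    destruct (Req_dec t 0) as [->|Hne].
    - unfold g. rewrite Rminus_0_r, Rminus_diag_eq, Rmult_0_l, Rabs_R0 by reflexivity. lra.
    - rewrite Hgq by lra. pose proof (Hsin t ltac:(lra)) as Hst.
      pose proof (sin_ge_half (t / 2) ltac:(lra)) as Hsh.
      unfold q. rewrite Rabs_mult, Rabs_div, (Rabs_pos_eq (sin (t / 2))) by lra.
      pose proof (Rabs_sin_le_1 ((INR N + / 2) * t)).
      pose proof (cosh_increment_bound a t Ha ltac:(lra)) as Hh. fold L in Hh. fold (h t) in Hh.
      assert (Hq : Rabs (h t) / sin (t / 2) <= 4 * L).
      { apply Rmult_le_reg_r with (sin (t / 2)); auto.
        replace (Rabs (h t) / sin (t / 2) * sin (t / 2)) with (Rabs (h t)) by (field; lra). nra. }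
      pose proof (Rabs_pos (sin ((INR N + / 2) * t))).
      assert (0 <= Rabs (h t) / sin (t / 2)).
      { apply Rmult_le_pos; [apply Rabs_pos|apply Rlt_le, Rinv_0_lt_compat; auto]. }
      nra. }
  assert (B2 : Rabs (RInt g d PI) <= C / (INR N + / 2)).
  { apply HC.
    - pose proof (pos_INR N). lra.
    - apply (is_RInt_ext g); [|now apply (RInt_correct (V := R_CompleteNormedModule))].
      intros t. rewrite Rmin_left, Rmax_right by lra. intros Ht. apply Hgq. lra. }
  assert (B3 : C / (INR N + / 2) <= eps / 2).
  { assert (HNp : 0 < INR N0) by now apply lt_0_INR.
    assert (HNN : INR N0 <= INR N) by now apply le_INR.
    pose proof (Rabs_pos C). pose proof (Rle_abs C).
    apply Rle_trans with ((Rabs C + 1) * / INR N0).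
    - apply Rmult_le_reg_r with (INR N + / 2); [lra|].
      replace (C / (INR N + / 2) * (INR N + / 2)) with C by (field; lra).
      apply Rmult_le_reg_r with (INR N0); [lra|].
      replace ((Rabs C + 1) * / INR N0 * (INR N + / 2) * INR N0)
        with ((Rabs C + 1) * (INR N + / 2)) by (field; lra).
      assert (C * INR N0 <= Rabs C * INR N0) by (apply Rmult_le_compat_r; lra).
      nra.
    - apply Rlt_le in HN0. apply Rmult_le_compat_l with (r := Rabs C + 1) in HN0; [|lra].
      replace ((Rabs C + 1) * (eps / (2 * (Rabs C + 1)))) with (eps / 2) in HN0 by (field; lra).
      exact HN0. }
  replace v with (RInt g 0 d + RInt g d PI).
  - eapply Rle_trans; [apply Rabs_triang|]. lra.
  - rewrite <- (is_RInt_unique (V := R_CompleteNormedModule) _ _ _ _ HI).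
    exact (RInt_Chasles (V := R_CompleteNormedModule) g 0 d PI Ex1 Ex2).
Qed.

(** Comparison with the telescoping sum of 1 / m - 1 / (m + 1), uniform in a. *)
Lemma even_sum_tail (a : R) (N j : nat) : 0 < a -> (1 <= N)%nat ->
  0 <= even_sum (fun n => / (a ^ 2 + INR n ^ 2)) (N + j)
     - even_sum (fun n => / (a ^ 2 + INR n ^ 2)) N
  <= 2 * (/ INR N - / INR (N + j)).
Proof.
  intros Ha HN. assert (HNp : 1 <= INR N) by now apply (le_INR 1).
  induction j as [|j IH].
  - rewrite Nat.add_0_r. lra.
  - rewrite Nat.add_succ_r. cbn [even_sum].
    assert (Hm : 1 <= INR (N + j)) by (apply (le_INR 1); lia).
    rewrite S_INR. set (m := INR (N + j)) in *.
    pose proof (sum_sqr_pos a (m + 1) Ha) as Hp.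
    pose proof (Rinv_0_lt_compat _ Hp).
    assert (/ (a ^ 2 + (m + 1) ^ 2) <= / m - / (m + 1)).
    { replace (/ m - / (m + 1)) with (/ (m * (m + 1))) by (field; lra).
      apply Rinv_le_contravar; nra. }
    lra.
Qed.

Lemma sinh_pos (x : R) : 0 < x -> 0 < sinh x.
Proof. intros H. rewrite <- sinh_0. now apply sinh_lt. Qed.

(** Convergence alone has no rate uniform in a. The rate comes from the tail: go on to N + N0 terms,
    where the error is below eps, return to N by the telescoping bound, and let eps vanish. *)
Lemma coth_partial_fractions (a : R) (N : nat) : 0 < a -> (1 <= N)%nat ->
  Rabs (PI * cosh (a * PI) / sinh (a * PI) - even_sum (fun n => a / (a ^ 2 + INR n ^ 2)) N)
  <= 2 * a / INR N.
Proof.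
  intros Ha HN.
  assert (HNp : 1 <= INR N) by now apply (le_INR 1).
  assert (Hs : 0 < sinh (a * PI)) by (apply sinh_pos, Rmult_lt_0_compat; [lra|apply PI_RGT_0]).
  rewrite (even_sum_scal a (fun n => / (a ^ 2 + INR n ^ 2))).
  set (S0 := even_sum (fun n => / (a ^ 2 + INR n ^ 2))).
  apply le_epsilon. intros eps Heps.
  destruct (dirichlet_remainder_small a (eps * sinh (a * PI)) Ha) as [N0 HN0].
  { now apply Rmult_lt_0_compat. }
  specialize (HN0 (N + N0)%nat ltac:(lia)). fold S0 in HN0.
  pose proof (even_sum_tail a N N0 Ha HN) as HT. fold S0 in HT.
  assert (0 <= / INR (N + N0)) by (apply Rlt_le, Rinv_0_lt_compat, lt_0_INR; lia).
  replace (PI * cosh (a * PI) / sinh (a * PI) - a * S0 N)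
    with (- ((a * sinh (a * PI) * S0 (N + N0)%nat - PI * cosh (a * PI)) / sinh (a * PI))
          + a * (S0 (N + N0)%nat - S0 N)) by (field; lra).
  rewrite Rplus_comm. eapply Rle_trans; [apply Rabs_triang|]. apply Rplus_le_compat.
  - rewrite Rabs_mult, !Rabs_pos_eq by lra. unfold Rdiv. rewrite (Rmult_comm 2), Rmult_assoc.
    apply Rmult_le_compat_l; lra.
  - rewrite Rabs_Ropp, Rabs_div, (Rabs_pos_eq (sinh _)) by lra.
    apply Rmult_le_reg_r with (sinh (a * PI)); auto.
    match goal with |- ?A / ?B * ?B <= _ => replace (A / B * B) with A by (field; lra) end.
    exact HN0.
Qed.

(** The case a = x / beta, divided by beta. An error linear in x is harmless against the decay of a
    Schwartz function. *)
Lemma coth_partial_fractions_scaled (beta x : R) (N : nat) :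
  0 < beta -> 0 < x -> (1 <= N)%nat ->
  Rabs (PI / beta * (cosh (PI * x / beta) / sinh (PI * x / beta))
        - even_sum (fun n => x / ((INR n * beta) ^ 2 + x ^ 2)) N)
  <= 2 / beta ^ 2 * x / INR N.
Proof.
  intros Hb Hx HN.
  assert (HNp : 1 <= INR N) by now apply (le_INR 1).
  assert (Ha : 0 < x / beta) by now apply Rdiv_lt_0_compat.
  pose proof (coth_partial_fractions (x / beta) N Ha HN) as H.
  assert (Hs : 0 < sinh (x / beta * PI)) by (apply sinh_pos, Rmult_lt_0_compat; [lra|apply PI_RGT_0]).
  rewrite (even_sum_ext _ (fun n => beta * (x / ((INR n * beta) ^ 2 + x ^ 2)))) in H.
  2: { intros n. field. repeat split; nra. }
  rewrite even_sum_scal in H.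
  replace (PI * x / beta) with (x / beta * PI) by (field; lra).
  apply Rmult_le_reg_l with beta; auto.
  rewrite <- (Rabs_pos_eq beta) at 1 by lra. rewrite <- Rabs_mult.
  replace (beta * (2 / beta ^ 2 * x / INR N)) with (2 * (x / beta) / INR N) by (field; lra).
  match goal with |- Rabs ?A <= _ => match type of H with Rabs ?B <= _ =>
    replace A with B by (field; lra) end end.
  exact H.
Qed.

(** * Duality between the hyperbolic kernels *)

Lemma exp_minus_one_ge (y : R) : 0 < y -> y < exp y - 1.
Proof. intros Hy. pose proof (exp_ineq1 y). lra. Qed.

(** A finite geometric series: 1 + 2 / (e^(beta k) - 1) is coth(beta k / 2), and the last quotient
    is the exact remainder. *)
Lemma even_sum_exp (beta k : R) (N : nat) : 0 < beta -> 0 < k ->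
  even_sum (fun n => exp (- (INR n * beta) * k)) N =
  1 + 2 / (exp (beta * k) - 1) - 2 * exp (- (INR N * beta) * k) / (exp (beta * k) - 1).
Proof.
  intros Hb Hk. pose proof (exp_minus_one_ge (beta * k) ltac:(nra)) as H1.
  assert (H2 : 0 < beta * k) by nra.
  induction N as [|N IH].
  - simpl. rewrite Rmult_0_l, Ropp_0, Rmult_0_l, exp_0. field. lra.
  - cbn [even_sum]. rewrite IH.
    replace (- (INR N * beta) * k) with (- (INR (S N) * beta) * k + beta * k)
      by (rewrite S_INR; ring).
    rewrite exp_plus. field. lra.
Qed.

(** With z = y / c, e^(2 z) >= (1 + z)^2 >= 1 + z^2. The exponential remainder is thereby dominated
    by a Poisson kernel whose integral is already known. *)
Lemma exp_neg_le_lorentz (c y : R) : 0 < c -> 0 <= y -> exp (- (2 / c) * y) <= c ^ 2 / (c ^ 2 + y ^ 2).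
Proof.
  intros Hc Hy. pose proof (sum_sqr_pos c y Hc).
  replace (- (2 / c) * y) with (- (y / c + y / c)) by (field; lra).
  rewrite exp_Ropp, exp_plus.
  assert (H1 : 0 <= y / c) by (apply Rmult_le_pos; [lra|apply Rlt_le, Rinv_0_lt_compat; lra]).
  pose proof (exp_ineq1_le (y / c)) as H2.
  replace (c ^ 2 / (c ^ 2 + y ^ 2)) with (/ (1 + (y / c) * (y / c))) by (field; split; nra).
  apply Rinv_le_contravar; nra.
Qed.

(** Termwise Laplace transforms with a = n beta, the term n = 0 being the undamped identity.
    Admissibility goes through the induction together with the equality, since additivity of
    [half_int] depends on it. *)
Lemma sin_transform_partial_sums (f : R -> R) (beta : R) (N : nat) :
  0 < beta -> schwartz_R f -> (forall x, f (- x) = - f x) ->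
  admissible (fun k => trig_transform (PI / 2) f k * even_sum (fun n => exp (- (INR n * beta) * k)) N) /\
  admissible (fun x => f x * even_sum (fun n => x / ((INR n * beta) ^ 2 + x ^ 2)) N) /\
  half_int (fun k => trig_transform (PI / 2) f k * even_sum (fun n => exp (- (INR n * beta) * k)) N) =
  half_int (fun x => f x * even_sum (fun n => x / ((INR n * beta) ^ 2 + x ^ 2)) N).
Proof.
  intros Hb Hf Ho.
  pose proof (sin_transform_fast f Hf Ho) as HT.
  pose proof (schwartz_fast f Hf) as Ff.
  pose proof (odd_schwartz_vanishing f Hf Ho) as Hv.
  induction N as [|N [IH1 [IH2 IH3]]].
  - assert (E1 : forall k, 0 < k -> trig_transform (PI / 2) f k =
              trig_transform (PI / 2) f k * even_sum (fun n => exp (- (INR n * beta) * k)) 0).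
    { intros k _. simpl. rewrite Rmult_0_l, Ropp_0, Rmult_0_l, exp_0. ring. }
    assert (E2 : forall x, 0 < x -> f x * / x =
              f x * even_sum (fun n => x / ((INR n * beta) ^ 2 + x ^ 2)) 0).
    { intros x Hx. simpl. field. lra. }
    assert (A2 := vanishing_inv_admissible f Ff Hv).
    split; [|split].
    + apply (admissible_ext (trig_transform (PI / 2) f)); auto using fast_admissible.
    + apply (admissible_ext (fun x => f x * / x)); auto.
    + rewrite <- (half_int_ext _ _ E1), <- (half_int_ext _ _ E2) by auto using fast_admissible.
      now apply half_int_sin_transform.
  - set (a := INR (S N) * beta).
    assert (Ha : 0 < a) by (apply Rmult_lt_0_compat; auto; apply lt_0_INR; lia).
    destruct (half_int_exp_damping _ a HT Ha) as [A3 _].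
    assert (A4 := conjugate_lorentz_admissible a f Ha Ff).
    assert (E1 : forall k, 0 < k ->
       trig_transform (PI / 2) f k * even_sum (fun n => exp (- (INR n * beta) * k)) N
       + 2 * (exp (- a * k) * trig_transform (PI / 2) f k)
       = trig_transform (PI / 2) f k * even_sum (fun n => exp (- (INR n * beta) * k)) (S N)).
    { intros k _. cbn [even_sum]. fold a. ring. }
    assert (E2 : forall x, 0 < x ->
       f x * even_sum (fun n => x / ((INR n * beta) ^ 2 + x ^ 2)) N
       + 2 * (f x * (x / (a ^ 2 + x ^ 2)))
       = f x * even_sum (fun n => x / ((INR n * beta) ^ 2 + x ^ 2)) (S N)).
    { intros x _. cbn [even_sum]. fold a. ring. }
    split; [|split].
    + apply (admissible_ext _ _ E1). auto using admissible_plus, admissible_scal.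
    + apply (admissible_ext _ _ E2). auto using admissible_plus, admissible_scal.
    + rewrite <- (half_int_ext _ _ E1), <- (half_int_ext _ _ E2)
        by auto using admissible_plus, admissible_scal.
      rewrite !half_int_plus, !half_int_scal by auto using admissible_scal.
      rewrite IH3, (half_int_laplace_sin_transform a f Ha Ff). reflexivity.
Qed.

(** Real profiles of the kernels of the theorem: [h_fun] is -i times [coth_kernel] and [g_fun] is i
    times [csch_kernel]. *)
Definition coth_kernel (beta x : R) : R :=
  PI / beta * (cosh (PI * x / beta) / sinh (PI * x / beta)).

Definition csch_kernel (beta x : R) : R := PI / (beta * sinh (PI * x / beta)).

Lemma sinh_ge (y : R) : 0 < y -> y <= sinh y.
Proof.
  intros Hy. destruct (mean_value sinh cosh 0 y) as [c [_ E]].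
  { intros t. apply is_derive_Reals, derivable_pt_lim_sinh. }
  rewrite sinh_0 in E. rewrite !Rminus_0_r in E. rewrite E.
  assert (1 <= cosh c).
  { unfold cosh. pose proof (exp_pos c). rewrite exp_Ropp.
    assert (0 <= (exp c - 1) ^ 2 * / exp c).
    { apply Rmult_le_pos; [apply pow2_ge_0|apply Rlt_le, Rinv_0_lt_compat; auto]. }
    replace ((exp c - 1) ^ 2 * / exp c) with (exp c + / exp c - 2) in H0 by (field; lra).
    lra. }
  nra.
Qed.

Lemma scaled_arg_pos (beta x : R) : 0 < beta -> 0 < x -> 0 < PI * x / beta.
Proof.
  intros. apply Rdiv_lt_0_compat; auto. apply Rmult_lt_0_compat; auto. apply PI_RGT_0.
Qed.

Lemma csch_kernel_bound (beta x : R) : 0 < beta -> 0 < x -> 0 < csch_kernel beta x <= / x.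
Proof.
  intros Hb Hx. pose proof (scaled_arg_pos beta x Hb Hx) as Hy.
  pose proof (sinh_ge _ Hy) as Hs. pose proof PI_RGT_0 as HP.
  unfold csch_kernel. split.
  - apply Rdiv_lt_0_compat; auto. apply Rmult_lt_0_compat; lra.
  - replace (/ x) with (PI / (beta * (PI * x / beta))) by (field; lra).
    apply Rmult_le_compat_l; [lra|]. apply Rinv_le_contravar.
    + now apply Rmult_lt_0_compat.
    + apply Rmult_le_compat_l; lra.
Qed.

Lemma coth_kernel_bound (beta x : R) : 0 < beta -> 0 < x ->
  Rabs (coth_kernel beta x) <= (1 + PI / beta) * (1 + / x).
Proof.
  intros Hb Hx. pose proof (scaled_arg_pos beta x Hb Hx) as Hy.
  pose proof (sinh_pos _ Hy) as Hs. pose proof PI_RGT_0 as HP.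
  pose proof (csch_kernel_bound beta x Hb Hx) as [Hc0 Hc1].
  assert (Hpb : 0 < PI / beta) by now apply Rdiv_lt_0_compat.
  (* From cosh y = sinh y + e^(- y): the constant bounds the kernel at infinity, the other term
     carries the pole. *)
  assert (E : coth_kernel beta x = PI / beta + csch_kernel beta x * exp (- (PI * x / beta))).
  { unfold coth_kernel, csch_kernel, cosh, sinh in *. set (y := PI * x / beta) in *. field. lra. }
  assert (Hexp : exp (- (PI * x / beta)) <= 1).
  { rewrite <- exp_0. left. apply exp_increasing. lra. }
  pose proof (exp_pos (- (PI * x / beta))).
  rewrite E, Rabs_pos_eq by nra.
  pose proof (Rinv_0_lt_compat x Hx). nra.
Qed.

Lemma continuous_kernels (beta x : R) : 0 < beta -> 0 < x ->
  continuous (coth_kernel beta) x /\ continuous (csch_kernel beta) x.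
Proof.
  intros Hb Hx. pose proof (sinh_pos _ (scaled_arg_pos beta x Hb Hx)) as Hs.
  unfold sinh in Hs.
  split; apply @ex_derive_continuous; unfold coth_kernel, csch_kernel, cosh, sinh; auto_derive.
  - unfold Rdiv, Rminus in Hs. lra.
  - unfold Rdiv, Rminus in Hs. apply Rmult_integral_contrapositive_currified; lra.
Qed.

Lemma bose_bound (beta k : R) : 0 < beta -> 0 < k ->
  0 < / (exp (beta * k) - 1) <= / beta * / k.
Proof.
  intros Hb Hk. assert (Hbk : 0 < beta * k) by nra.
  pose proof (exp_minus_one_ge (beta * k) Hbk). split.
  - apply Rinv_0_lt_compat. lra.
  - rewrite <- Rinv_mult. apply Rinv_le_contravar; lra.
Qed.

Lemma continuous_bose (beta k : R) : 0 < beta -> 0 < k ->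
  continuous (fun k => 1 + 2 / (exp (beta * k) - 1)) k.
Proof.
  intros Hb Hk. assert (Hbk : 0 < beta * k) by nra.
  pose proof (exp_minus_one_ge (beta * k) Hbk).
  apply @ex_derive_continuous. auto_derive. lra.
Qed.

(** Both sides are compared with their N-th partial sums, whose integrals agree exactly, and each
    comparison costs O(1 / N). *)
Lemma coth_duality (f : R -> R) (beta : R) :
  0 < beta -> schwartz_R f -> (forall x, f (- x) = - f x) ->
  admissible (fun k => trig_transform (PI / 2) f k * (1 + 2 / (exp (beta * k) - 1))) /\
  admissible (fun x => f x * coth_kernel beta x) /\
  half_int (fun k => trig_transform (PI / 2) f k * (1 + 2 / (exp (beta * k) - 1))) =
  half_int (fun x => f x * coth_kernel beta x).
Proof.
  intros Hb Hf Ho. set (T := trig_transform (PI / 2) f).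
  pose proof (sin_transform_fast f Hf Ho) as HT. fold T in HT.
  pose proof (sin_transform_vanishing f Hf Ho) as HTv. fold T in HTv.
  pose proof (schwartz_fast f Hf) as Ff.
  pose proof (odd_schwartz_vanishing f Hf Ho) as Hv.
  pose proof (Rinv_0_lt_compat beta Hb) as Hib. pose proof PI_RGT_0 as HPI.
  assert (A1 : admissible (fun k => T k * (1 + 2 / (exp (beta * k) - 1)))).
  { destruct HT as [MT HMT]. apply vanishing_mult with (1 + 2 * / beta); auto.
    - lra.
    - intros k Hk. now apply HMT.
    - intros k Hk. now apply continuous_bose.
    - intros k Hk. pose proof (bose_bound beta k Hb Hk). pose proof (Rinv_0_lt_compat k Hk).
      unfold Rdiv. rewrite Rabs_pos_eq by lra. nra. }
  assert (A2 : admissible (fun x => f x * coth_kernel beta x)).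
  { apply vanishing_mult with (1 + PI / beta); auto.
    - assert (0 < PI / beta) by now apply Rdiv_lt_0_compat. lra.
    - intros x Hx. now apply schwartz_continuous.
    - intros x Hx. now apply continuous_kernels.
    - intros x Hx. now apply coth_kernel_bound. }
  split; [exact A1|split; [exact A2|]].
  destruct HTv as [M [HM0 HM]]. destruct Hv as [M' [HM0' HM']].
  (* 2 M / beta bounds |T k| times twice the Bose factor, the zero of T cancelling the pole. The
     rest is N times the integral of c^2 / (c^2 + k^2), which is c PI / 2 for the width c = 2 / (N
     beta). *)
  set (C1 := 2 * M * / beta * (2 / beta * (PI / 2))).
  set (C2 := 2 / beta ^ 2 * M' * (PI / 2)).
  assert (Hb2 : 0 < 2 / beta ^ 2) by (apply Rdiv_lt_0_compat; nra).
  apply eq_of_linear_bound with (C1 + C2). intros a Ha.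
  destruct (archimed_cor1 a) as [N [HNa HN]]; [lra|].
  assert (HNp : 1 <= INR N) by now apply (le_INR 1).
  destruct (sin_transform_partial_sums f beta N Hb Hf Ho) as [A3 [A4 E]]. fold T in A3, E.
  assert (B1 : Rabs (half_int (fun k => T k * (1 + 2 / (exp (beta * k) - 1)))
     - half_int (fun k => T k * even_sum (fun n => exp (- (INR n * beta) * k)) N)) <= C1 * / INR N).
  { rewrite <- half_int_minus by auto.
    set (c := 2 / (INR N * beta)).
    assert (Hc : 0 < c) by (apply Rdiv_lt_0_compat; nra).
    replace (C1 * / INR N) with (2 * M * / beta * c * (PI / 2)) by (unfold C1, c; field; split; lra).
    rewrite <- (half_int_lorentz c Hc), <- half_int_scal by now apply lorentz_kernel_admissible.
    apply half_int_abs_le.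
    - auto using admissible_minus.
    - now apply admissible_scal, lorentz_kernel_admissible.
    - intros k Hk. rewrite even_sum_exp by auto.
      pose proof (bose_bound beta k Hb Hk) as [Hn0 Hn1].
      set (n := / (exp (beta * k) - 1)) in *.
      replace (T k * (1 + 2 / (exp (beta * k) - 1)) -
        T k * (1 + 2 / (exp (beta * k) - 1) - 2 * exp (- (INR N * beta) * k) / (exp (beta * k) - 1)))
        with (T k * (2 * n * exp (- (2 / c) * k))).
      2: { replace (2 / c) with (INR N * beta) by (unfold c; field; split; lra).
           unfold n, Rdiv. ring. }
      pose proof (exp_pos (- (2 / c) * k)) as He0.
      pose proof (exp_neg_le_lorentz c k Hc ltac:(lra)) as He1.
      rewrite Rabs_mult, (Rabs_pos_eq (2 * n * _)) by (apply Rmult_le_pos; lra).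
      assert (HTk : Rabs (T k) <= M * k).
      { eapply Rle_trans; [now apply HM|].
        assert (0 <= M * k) by nra. assert (1 <= (1 + k ^ 2) ^ 2) by nra.
        apply Rmult_le_reg_r with ((1 + k ^ 2) ^ 2); [lra|].
        replace (M * k / (1 + k ^ 2) ^ 2 * (1 + k ^ 2) ^ 2) with (M * k) by (field; nra). nra. }
      apply Rle_trans with (M * k * (2 * (/ beta * / k) * (c ^ 2 / (c ^ 2 + k ^ 2)))).
      + apply Rmult_le_compat; auto using Rabs_pos; [apply Rmult_le_pos; lra|].
        apply Rmult_le_compat; lra.
      + right. pose proof (sum_sqr_pos c k Hc). field. repeat split; lra. }
  assert (B2 : Rabs (half_int (fun x => f x * coth_kernel beta x)
     - half_int (fun x => f x * even_sum (fun n => x / ((INR n * beta) ^ 2 + x ^ 2)) N)) <= C2 * / INR N).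
  { rewrite <- half_int_minus by auto.
    replace (C2 * / INR N) with (2 / beta ^ 2 * M' * / INR N * (PI / 2)) by (unfold C2; ring).
    rewrite <- (half_int_lorentz 1 Rlt_0_1), <- half_int_scal
      by (apply lorentz_kernel_admissible; lra).
    apply half_int_abs_le.
    - auto using admissible_minus.
    - apply admissible_scal, lorentz_kernel_admissible; lra.
    - intros x Hx. rewrite <- Rmult_minus_distr_l, Rabs_mult.
      apply Rle_trans with (M' * x / (1 + x ^ 2) ^ 2 * (2 / beta ^ 2 * x / INR N)).
      + apply Rmult_le_compat; auto using Rabs_pos. now apply coth_partial_fractions_scaled.
      + replace (M' * x / (1 + x ^ 2) ^ 2 * (2 / beta ^ 2 * x / INR N))
          with (2 / beta ^ 2 * M' * / INR N * (x ^ 2 / (1 + x ^ 2) ^ 2)) by (field; repeat split; nra).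
        apply Rmult_le_compat_l.
        { apply Rmult_le_pos; [nra|]. apply Rlt_le, Rinv_0_lt_compat; lra. }
        replace (1 / (1 ^ 2 + x ^ 2)) with ((1 + x ^ 2) / (1 + x ^ 2) ^ 2) by (field; nra).
        apply Rmult_le_compat_r; [apply Rlt_le, Rinv_0_lt_compat; nra|lra]. }
  rewrite E in B1. revert B1 B2.
  generalize (half_int (fun k => T k * (1 + 2 / (exp (beta * k) - 1))))
    (half_int (fun x => f x * even_sum (fun n => x / ((INR n * beta) ^ 2 + x ^ 2)) N))
    (half_int (fun x => f x * coth_kernel beta x)).
  intros p q r B1 B2. replace (p - r) with ((p - q) - (r - q)) by ring.
  eapply Rle_trans; [apply Rabs_triang|]. rewrite Rabs_Ropp.
  assert (Hib2 : 0 < 2 / beta) by (apply Rdiv_lt_0_compat; lra).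
  assert (HC1 : 0 <= C1).
  { unfold C1. apply Rmult_le_pos; [|apply Rmult_le_pos; lra].
    apply Rmult_le_pos; lra. }
  assert (HC2 : 0 <= C2) by (unfold C2; apply Rmult_le_pos; [apply Rmult_le_pos|]; lra).
  assert ((C1 + C2) * / INR N <= (C1 + C2) * a) by (apply Rmult_le_compat_l; lra).
  lra.
Qed.

(** This is 1 / sinh(2 z) = coth z - coth(2 z) at z = PI x / (2 beta), which becomes rational in p =
    e^z. *)
Lemma csch_from_coth (beta x : R) : 0 < beta -> 0 < x ->
  csch_kernel beta x = 2 * coth_kernel (2 * beta) x - coth_kernel beta x.
Proof.
  intros Hb Hx.
  pose proof (sinh_pos _ (scaled_arg_pos (2 * beta) x ltac:(lra) Hx)) as Hs.
  pose proof (sinh_pos _ (scaled_arg_pos beta x Hb Hx)) as Hs2.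
  unfold csch_kernel, coth_kernel, cosh, sinh in *. revert Hs Hs2.
  replace (PI * x / beta) with (PI * x / (2 * beta) + PI * x / (2 * beta)) by (field; lra).
  set (y := PI * x / (2 * beta)). rewrite !exp_Ropp, exp_plus.
  pose proof (exp_pos y). set (p := exp y) in *. intros Hs Hs2.
  assert (Hp : 0 < p * p - 1).
  { apply Rmult_lt_reg_r with (/ p / 2); [apply Rdiv_lt_0_compat; [now apply Rinv_0_lt_compat|lra]|].
    replace ((p * p - 1) * (/ p / 2)) with ((p - / p) / 2) by (field; lra). lra. }
  field. repeat split; try lra.
  all: try (assert (1 < p * p * (p * p)) by nra; simpl; nra).
Qed.

(** The same combination, twice the case 2 beta minus the case beta, produces tanh(beta k / 2) = 1 -
    2 / (e^(beta k) + 1) on one side and 1 / sinh on the other, so no second expansion is needed. *)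
Lemma tanh_duality (f : R -> R) (beta : R) :
  0 < beta -> schwartz_R f -> (forall x, f (- x) = - f x) ->
  admissible (fun k => trig_transform (PI / 2) f k * (1 - 2 / (exp (beta * k) + 1))) /\
  admissible (fun x => f x * csch_kernel beta x) /\
  half_int (fun k => trig_transform (PI / 2) f k * (1 - 2 / (exp (beta * k) + 1))) =
  half_int (fun x => f x * csch_kernel beta x).
Proof.
  intros Hb Hf Ho.
  destruct (coth_duality f beta Hb Hf Ho) as [A1 [A2 E]].
  destruct (coth_duality f (2 * beta) ltac:(lra) Hf Ho) as [A1' [A2' E']].
  set (T := trig_transform (PI / 2) f) in *.
  assert (F1 : forall k, 0 < k ->
     2 * (T k * (1 + 2 / (exp (2 * beta * k) - 1))) - T k * (1 + 2 / (exp (beta * k) - 1))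
     = T k * (1 - 2 / (exp (beta * k) + 1))).
  { intros k Hk. replace (2 * beta * k) with (beta * k + beta * k) by ring. rewrite exp_plus.
    pose proof (exp_minus_one_ge (beta * k) ltac:(nra)). assert (0 < beta * k) by nra.
    field. repeat split; nra. }
  assert (F2 : forall x, 0 < x ->
     2 * (f x * coth_kernel (2 * beta) x) - f x * coth_kernel beta x = f x * csch_kernel beta x).
  { intros x Hx. rewrite csch_from_coth by auto. ring. }
  assert (B1 := admissible_minus _ _ (admissible_scal 2 _ A1') A1).
  assert (B2 := admissible_minus _ _ (admissible_scal 2 _ A2') A2).
  split; [exact (admissible_ext _ _ F1 B1)|split; [exact (admissible_ext _ _ F2 B2)|]].
  rewrite <- (half_int_ext _ _ F1 B1), <- (half_int_ext _ _ F2 B2).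
  rewrite !half_int_minus, !half_int_scal by auto using admissible_scal.
  now rewrite E, E'.
Qed.

(** * Principal values *)

Lemma is_RInt_gen_reflect (f : R -> R) (a l : R) :
  is_RInt_gen (fun x => f (- x)) (at_point a) (Rbar_locally p_infty) l ->
  is_RInt_gen f (Rbar_locally m_infty) (at_point (- a)) l.
Proof.
  intros H P HP. destruct (H P HP) as [Q S HQ HS HQS].
  apply Filter_prod with (Q := fun b => S (- b)) (R := fun b => b = - a).
  - destruct HS as [m Hm]. exists (- m). intros x Hx. apply Hm. lra.
  - reflexivity.
  - intros b c Hb ->. destruct (HQS a (- b) HQ Hb) as [z [Hz HPz]]. exists z. split; auto.
    simpl in *.
    (* One sign comes from exchanging the endpoints, the other from the substitution x -> - x. *)
    replace z with (opp (opp z)) by apply opp_opp.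
    apply @is_RInt_swap.
    apply (is_RInt_ext (fun y => opp ((fun x => opp (f (- x))) (- y)))).
    { intros x _. unfold opp; simpl. now rewrite !Ropp_involutive. }
    apply (is_RInt_comp_opp (V := R_NormedModule) (fun x => opp (f (- x))) (- a) b (opp z)).
    rewrite Ropp_involutive.
    apply (is_RInt_opp (fun x => f (- x))). exact Hz.
Qed.

Lemma is_RInt_gen_pair (f g : R -> R) (Fa Fb : (R -> Prop) -> Prop)
    {FFa : Filter Fa} {FFb : Filter Fb} (lf lg : R) :
  is_RInt_gen f Fa Fb lf -> is_RInt_gen g Fa Fb lg ->
  is_RInt_gen (fun x => (f x, g x) : C) Fa Fb ((lf, lg) : C).
Proof.
  intros Hf Hg. apply filterlimi_locally. intros eps.
  pose proof (proj1 (filterlimi_locally _ _) Hf eps) as H1.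
  pose proof (proj1 (filterlimi_locally _ _) Hg eps) as H2.
  generalize (filter_and _ _ H1 H2). apply filter_imp.
  intros [a b] [[y [Hy By]] [z [Hz Bz]]]. exists (y, z). split.
  - apply (is_RInt_fct_extend_pair (U := R_NormedModule) (V := R_NormedModule)
      (fun x => (f x, g x))); assumption.
  - split; assumption.
Qed.

Lemma is_RInt_gen_Re_Im (F : R -> C) (Fa Fb : (R -> Prop) -> Prop)
    {FFa : Filter Fa} {FFb : Filter Fb} (l : C) :
  is_RInt_gen F Fa Fb l ->
  is_RInt_gen (fun x => Re (F x)) Fa Fb (Re l) /\ is_RInt_gen (fun x => Im (F x)) Fa Fb (Im l).
Proof.
  intros H. split; apply filterlimi_locally; intros eps;
    generalize (proj1 (filterlimi_locally _ _) H eps); apply filter_imp;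
    intros [a b] [z [Hz [B1 B2]]].
  - exists (Re z). split; [|exact B1].
    exact (is_RInt_fct_extend_fst (U := R_NormedModule) (V := R_NormedModule) F a b z Hz).
  - exists (Im z). split; [|exact B2].
    exact (is_RInt_fct_extend_snd (U := R_NormedModule) (V := R_NormedModule) F a b z Hz).
Qed.

(** Each half is dominated only away from 0, with a bound that may explode as c -> 0; the
    symmetrized integrand is admissible up to 0. No limit in the truncation has to be computed. *)
Definition is_pv (F : R -> R) (l : R) : Prop :=
  (forall c, 0 < c -> exists M, dominated c M F /\ dominated c M (fun x => F (- x))) /\
  admissible (fun x => F x + F (- x)) /\
  half_int (fun x => F x + F (- x)) = l.

Lemma is_pv_trunc (F : R -> R) (l : R) : is_pv F l ->
  exists J1 J2 : R -> R,
    (forall eps, 0 < eps ->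
      is_RInt_gen F (Rbar_locally m_infty) (at_point (- eps)) (J1 eps) /\
      is_RInt_gen F (at_point eps) (Rbar_locally p_infty) (J2 eps)) /\
    filterlim (fun eps => J1 eps + J2 eps) (at_right 0) (locally l).
Proof.
  intros [Hd [Ha <-]].
  exists (fun eps => RInt_gen (fun x => F (- x)) (at_point eps) (Rbar_locally p_infty)).
  exists (fun eps => RInt_gen F (at_point eps) (Rbar_locally p_infty)).
  assert (H : forall eps, 0 < eps ->
    is_RInt_gen (fun x => F (- x)) (at_point eps) (Rbar_locally p_infty)
      (RInt_gen (fun x => F (- x)) (at_point eps) (Rbar_locally p_infty)) /\
    is_RInt_gen F (at_point eps) (Rbar_locally p_infty)
      (RInt_gen F (at_point eps) (Rbar_locally p_infty))).
  { intros eps Heps. destruct (Hd (eps / 2)) as [M [H1 H2]]; [lra|].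
    split; eapply dominated_tail_int; eauto; lra. }
  split.
  - intros eps Heps. destruct (H eps Heps). split; auto. now apply is_RInt_gen_reflect.
  - apply filterlim_tail_int; auto. intros eps Heps. destruct (H eps Heps) as [H1 H2].
    rewrite Rplus_comm. apply (is_RInt_gen_plus F (fun x => F (- x))); auto.
Qed.

(** Symmetric truncation already cancels the poles, so the truncated integrals converge and all
    counterterms are zero. *)
Lemma fp_int_of_pv (F : R -> C) (A B : R -> R) (a b : R) :
  (forall x, F x = (A x, B x)) -> is_pv A a -> is_pv B b -> fp_int F (a, b).
Proof.
  intros E HA HB.
  destruct (is_pv_trunc A a HA) as [A1 [A2 [HA1 HA2]]].
  destruct (is_pv_trunc B b HB) as [B1 [B2 [HB1 HB2]]].
  exists (fun eps => (A1 eps + A2 eps, B1 eps + B2 eps)). split.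
  - intros eps Heps. destruct (HA1 eps Heps) as [P1 P2]. destruct (HB1 eps Heps) as [Q1 Q2].
    exists (A1 eps, B1 eps), (A2 eps, B2 eps).
    replace F with (fun x => (A x, B x) : C)
      by (apply functional_extensionality; intros; now rewrite E).
    split; [|split; [|reflexivity]]; apply is_RInt_gen_pair; auto; typeclasses eauto.
  (* With n = 0 the sum still contains the term a_0 / eps, hence the zero coefficient. *)
  - exists 0%nat, (fun _ => RtoC 0), (RtoC 0).
    apply (filterlim_ext (fun eps => (A1 eps + A2 eps, B1 eps + B2 eps) : C)).
    { intros eps. rewrite sum_O. symmetry.
      rewrite !Cmult_0_l. unfold Cminus, Cplus, Copp; simpl. f_equal; ring. }
    apply filterlim_locally. intros eps.
    pose proof (HA2 _ (locally_ball a eps)) as H1. pose proof (HB2 _ (locally_ball b eps)) as H2.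
    unfold filtermap in H1, H2.
    generalize (filter_and _ _ H1 H2). apply filter_imp. intros x [K1 K2]. split; assumption.
Qed.

(** Allowing every larger M' lets the two halves of the line share one bound. *)
Lemma dominated_kernel_mult (A kappa : R -> R) (C c : R) :
  0 <= C -> 0 < c -> fast A -> (forall x, 0 < x -> continuous kappa x) ->
  (forall x, 0 < x -> Rabs (kappa x) <= C * (1 + / x)) ->
  exists M, forall M', M <= M' -> dominated c M' (fun x => A x * kappa x).
Proof.
  intros HC Hc [M HM] Hk Hb. exists (Rabs M * (C * (1 + / c))). intros M' HM' x Hx.
  destruct (HM x ltac:(lra)) as [Hcont Hbd]. split.
  - apply (continuous_mult A kappa); auto. apply Hk. lra.
  - rewrite Rabs_mult.
    assert (0 < 1 + x ^ 2) by nra. assert (1 <= 1 + x ^ 2) by nra.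
    assert (Hix : / x <= / c) by (apply Rinv_le_contravar; lra).
    assert (0 < / x) by (apply Rinv_0_lt_compat; lra).
    apply Rle_trans with (Rabs M / (1 + x ^ 2) * (C * (1 + / c))).
    + apply Rmult_le_compat; auto using Rabs_pos.
      * eapply Rle_trans; [exact Hbd|]. pose proof (Rle_abs M). pose proof (Rabs_pos M).
        apply Rmult_le_reg_r with ((1 + x ^ 2) ^ 2); [nra|].
        replace (M / (1 + x ^ 2) ^ 2 * (1 + x ^ 2) ^ 2) with M by (field; nra).
        replace (Rabs M / (1 + x ^ 2) * (1 + x ^ 2) ^ 2) with (Rabs M * (1 + x ^ 2)) by (field; nra).
        nra.
      * eapply Rle_trans; [apply Hb; lra|]. apply Rmult_le_compat_l; lra.
    + unfold Rdiv. replace (Rabs M * / (1 + x ^ 2) * (C * (1 + / c)))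
        with (Rabs M * (C * (1 + / c)) * / (1 + x ^ 2)) by ring.
      apply Rmult_le_compat_r; auto. apply Rlt_le, Rinv_0_lt_compat; auto.
Qed.

Lemma is_pv_kernel_mult (A kappa : R -> R) (C l : R) :
  0 <= C -> fast A -> fast (fun x => A (- x)) ->
  (forall x, 0 < x -> continuous kappa x) ->
  (forall x, 0 < x -> continuous (fun x => kappa (- x)) x) ->
  (forall x, 0 < x -> Rabs (kappa x) <= C * (1 + / x)) ->
  (forall x, 0 < x -> Rabs (kappa (- x)) <= C * (1 + / x)) ->
  admissible (fun x => A x * kappa x + A (- x) * kappa (- x)) ->
  half_int (fun x => A x * kappa x + A (- x) * kappa (- x)) = l ->
  is_pv (fun x => A x * kappa x) l.
Proof.
  intros HC HA HA' Hk Hk' Hb Hb' Had Hl. split; [|split; auto].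
  intros c Hc.
  destruct (dominated_kernel_mult A kappa C c HC Hc HA Hk Hb) as [M1 H1].
  destruct (dominated_kernel_mult _ _ C c HC Hc HA' Hk' Hb') as [M2 H2].
  exists (Rmax M1 M2). split; [apply H1, Rmax_l|apply H2, Rmax_r].
Qed.

(** * Parity and reduction of the Fourier integral to the half line *)

Definition even_part (u : R -> R) (x : R) : R := u x + u (- x).
Definition odd_part (u : R -> R) (x : R) : R := u x - u (- x).

Lemma schwartz_even_part (u : R -> R) : schwartz_R u -> schwartz_R (even_part u).
Proof. intros H. apply (schwartz_plus u); auto. now apply schwartz_comp_opp. Qed.

Lemma schwartz_odd_part (u : R -> R) : schwartz_R u -> schwartz_R (odd_part u).
Proof. intros H. apply (schwartz_minus u); auto. now apply schwartz_comp_opp. Qed.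

Lemma even_part_even (u : R -> R) (x : R) : even_part u (- x) = even_part u x.
Proof. unfold even_part. rewrite Ropp_involutive. ring. Qed.

Lemma odd_part_odd (u : R -> R) (x : R) : odd_part u (- x) = - odd_part u x.
Proof. unfold odd_part. rewrite Ropp_involutive. ring. Qed.

(** Pairing x with - x against an odd kernel leaves the odd part of v, whose zero at 0 cancels the
    pole. *)
Lemma is_pv_odd_kernel (v kappa : R -> R) (C : R) :
  0 <= C -> schwartz_R v -> (forall x, kappa (- x) = - kappa x) ->
  (forall x, 0 < x -> continuous kappa x) ->
  (forall x, 0 < x -> Rabs (kappa x) <= C * (1 + / x)) ->
  is_pv (fun x => v x * kappa x) (half_int (fun x => odd_part v x * kappa x)).
Proof.
  intros HC Hv Ho Hk Hb.
  assert (E : forall x, 0 < x -> odd_part v x * kappa x = v x * kappa x + v (- x) * kappa (- x)).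
  { intros x _. rewrite Ho. unfold odd_part. ring. }
  assert (Had : admissible (fun x => odd_part v x * kappa x)).
  { apply vanishing_mult with C; auto.
    - apply odd_schwartz_vanishing; [now apply schwartz_odd_part|apply odd_part_odd].
    - intros x _. apply schwartz_continuous. now apply schwartz_odd_part. }
  apply is_pv_kernel_mult with C; auto.
  - now apply schwartz_fast.
  - now apply schwartz_fast, schwartz_comp_opp.
  - intros x Hx. apply (continuous_ext (fun x => - kappa x)); [intros; now rewrite Ho|].
    apply (continuous_opp kappa). auto.
  - intros x Hx. rewrite Ho, Rabs_Ropp. auto.
  - apply (admissible_ext _ _ E Had).
  - symmetry. apply (half_int_ext _ _ E Had).
Qed.

(** Cutting the line at 0 gives integrals from the point 0, while [half_int] approaches 0 from the
    right. Domination across 0, with c < 0, shows that they agree. *)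
Lemma half_int_from_point (f : R -> R) (c M l : R) :
  c < 0 -> dominated c M f -> is_RInt_gen f (at_point 0) (Rbar_locally p_infty) l ->
  half_int f = l.
Proof.
  intros Hc H Hl. pose proof (dominated_nonneg _ _ _ H) as HM.
  apply half_int_unique. replace l with (plus 0 l) by (unfold plus; simpl; ring).
  apply @is_RInt_gen_Chasles with 0; try typeclasses eauto; auto.
  apply filterlimi_locally. intros eps.
  assert (Hd : 0 < eps / (M + 1)) by (apply Rdiv_lt_0_compat; [apply eps|lra]).
  apply Filter_prod with (R := fun b => b = 0)
    (Q := fun a => 0 < a /\ Rabs (atan a - atan 0) < eps / (M + 1)).
  - apply (filter_and (F := at_right 0)); [apply at_right_gt|].
    exact (filterlim_atan_at_right 0 _ (locally_ball (atan 0) (mkposreal _ Hd))).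
  - reflexivity.
  - intros a b [Ha Hat] ->. simpl.
    destruct (dominated_ex_RInt c M f a 0) as [z Hz]; auto; [lra|].
    exists z. split; auto.
    pose proof (dominated_RInt_bound c M f a 0 z H ltac:(lra) Hc Hz) as Hb.
    change (Rabs (z - 0) < eps). rewrite Rminus_0_r.
    rewrite Rabs_minus_sym in Hb. pose proof (Rabs_pos (atan a - atan 0)).
    apply Rmult_lt_compat_l with (r := M + 1) in Hat; [|lra].
    replace ((M + 1) * (eps / (M + 1))) with (pos eps) in Hat by (field; lra). nra.
Qed.

Lemma line_int_half_int (q : R -> R) (M l : R) :
  (forall x, continuous q x) -> (forall x, Rabs (q x) <= M / (1 + x ^ 2)) ->
  is_RInt_gen q (Rbar_locally m_infty) (Rbar_locally p_infty) l ->
  l = half_int (fun x => q x + q (- x)).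
Proof.
  intros Hc Hb Hl.
  assert (D1 : dominated (-1) M q) by (intros x _; auto).
  assert (D2 : dominated (-1) M (fun x => q (- x))).
  { intros x _. split.
    - apply (continuous_comp Ropp q); auto. apply @ex_derive_continuous. auto_derive. exact I.
    - eapply Rle_trans; [apply Hb|]. right. f_equal. ring. }
  assert (T1 := dominated_tail_int _ _ _ D1 0 ltac:(lra)).
  assert (T2 := dominated_tail_int _ _ _ D2 0 ltac:(lra)).
  assert (Hd : forall c f, c < 0 -> dominated c M f -> admissible f).
  { intros c f Hc0 Hf. exists M. intros x Hx. apply Hf. lra. }
  rewrite half_int_plus by (apply (Hd (-1)); auto; lra).
  rewrite (half_int_from_point _ (-1) M _ ltac:(lra) D1 T1).
  rewrite (half_int_from_point _ (-1) M _ ltac:(lra) D2 T2).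
  apply is_RInt_gen_reflect in T2. rewrite Ropp_0 in T2.
  pose proof (is_RInt_gen_Chasles _ _ _ _ T2 T1) as T.
  rewrite <- (is_RInt_gen_unique (V := R_CompleteNormedModule) _ _ Hl).
  rewrite (is_RInt_gen_unique (V := R_CompleteNormedModule) _ _ T).
  unfold plus; simpl. ring.
Qed.

(** The odd part of u and the even part of v cancel in the pairing. Besides the formula, this yields
    the continuity and decay of the Fourier transform. *)
Lemma line_fourier_int (u v : R -> R) (k l : R) :
  schwartz_R u -> schwartz_R v ->
  is_RInt_gen (fun x => u x * cos (k * x) + v x * sin (k * x))
    (Rbar_locally m_infty) (Rbar_locally p_infty) l ->
  l = trig_transform 0 (even_part u) k + trig_transform (PI / 2) (odd_part v) k.
Proof.
  intros Hu Hv Hl.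
  assert (Hcc : forall x, continuous (fun x => cos (k * x)) x)
    by (intros; apply @ex_derive_continuous; auto_derive; exact I).
  assert (Hcs : forall x, continuous (fun x => sin (k * x)) x)
    by (intros; apply @ex_derive_continuous; auto_derive; exact I).
  destruct (schwartz_decay u Hu) as [Mu HMu]. destruct (schwartz_decay v Hv) as [Mv HMv].
  apply (line_int_half_int _ (Rabs Mu + Rabs Mv)) in Hl.
  - rewrite Hl. unfold trig_transform.
    rewrite <- half_int_plus
      by (apply trig_admissible, schwartz_fast; auto using schwartz_even_part, schwartz_odd_part).
    symmetry. apply half_int_ext.
    + intros x _. rewrite Rminus_0_r.
      replace (k * x - PI / 2) with (- (PI / 2 - k * x)) by ring.
      rewrite cos_neg, cos_shift. replace (k * - x) with (- (k * x)) by ring.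
      rewrite cos_neg, sin_neg. unfold even_part, odd_part. ring.
    + apply admissible_plus; apply trig_admissible, schwartz_fast;
        auto using schwartz_even_part, schwartz_odd_part.
  - intros x. apply (continuous_plus (fun x => u x * cos (k * x))).
    + apply (continuous_mult u); auto using schwartz_continuous.
    + apply (continuous_mult v); auto using schwartz_continuous.
  - intros x. eapply Rle_trans; [apply Rabs_triang|]. rewrite !Rabs_mult.
    pose proof (Rabs_cos_le_1 (k * x)). pose proof (Rabs_sin_le_1 (k * x)).
    specialize (HMu x). specialize (HMv x).
    pose proof (Rabs_pos (u x)). pose proof (Rabs_pos (v x)).
    assert (Hw : forall m, m / (1 + x ^ 2) ^ 2 <= Rabs m / (1 + x ^ 2)).
    { intros m. pose proof (Rle_abs m). pose proof (Rabs_pos m).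
      assert (1 <= 1 + x ^ 2) by nra.
      apply Rmult_le_reg_r with ((1 + x ^ 2) ^ 2); [nra|].
      replace (m / (1 + x ^ 2) ^ 2 * (1 + x ^ 2) ^ 2) with m by (field; nra).
      replace (Rabs m / (1 + x ^ 2) * (1 + x ^ 2) ^ 2) with (Rabs m * (1 + x ^ 2)) by (field; nra).
      nra. }
    pose proof (Hw Mu). pose proof (Hw Mv).
    replace ((Rabs Mu + Rabs Mv) / (1 + x ^ 2))
      with (Rabs Mu / (1 + x ^ 2) + Rabs Mv / (1 + x ^ 2)) by (field; nra).
    apply Rplus_le_compat; nra.
Qed.

Lemma fast_plus (f g : R -> R) : fast f -> fast g -> fast (fun x => f x + g x).
Proof.
  intros [M H] [N K]. exists (M + N). intros x Hx.
  destruct (H x Hx) as [Hc Hb]. destruct (K x Hx) as [Kc Kb]. split.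
  - apply (continuous_plus f g); auto.
  - eapply Rle_trans; [apply Rabs_triang|]. unfold Rdiv in *. lra.
Qed.

Lemma fast_opp (f : R -> R) : fast f -> fast (fun x => - f x).
Proof.
  intros [M H]. exists M. intros x Hx. destruct (H x Hx) as [Hc Hb]. split.
  - apply (continuous_opp f); auto.
  - now rewrite Rabs_Ropp.
Qed.

Lemma cos_transform_even (f : R -> R) (k : R) :
  trig_transform 0 f (- k) = trig_transform 0 f k.
Proof.
  unfold trig_transform. apply (f_equal half_int).
  apply functional_extensionality. intros x.
  replace (- k * x - 0) with (- (k * x - 0)) by ring. now rewrite cos_neg.
Qed.

Lemma sin_transform_odd (f : R -> R) (k : R) :
  fast f -> trig_transform (PI / 2) f (- k) = - trig_transform (PI / 2) f k.
Proof.
  intros Hf. unfold trig_transform.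
  replace (- half_int (fun x => f x * cos (k * x - PI / 2)))
    with ((-1) * half_int (fun x => f x * cos (k * x - PI / 2))) by ring.
  rewrite <- half_int_scal by now apply trig_admissible.
  apply half_int_ext; [|now apply trig_admissible]. intros x _.
  replace (- k * x - PI / 2) with (- (k * x - PI / 2) - PI) by field.
  replace (cos (- (k * x - PI / 2) - PI)) with (- cos (k * x - PI / 2)); [ring|].
  generalize (k * x - PI / 2). intros y.
  rewrite cos_minus, cos_PI, sin_PI, cos_neg. ring.
Qed.

(** [even_part] carries no factor 1/2, so its value at 0 is 2 u(0) and PI / 2 becomes PI. *)
Lemma half_int_cos_even_part (u : R -> R) :
  schwartz_R u -> half_int (trig_transform 0 (even_part u)) = PI * u 0.
Proof.
  intros Hu. rewrite half_int_cos_transform.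
  - unfold even_part. rewrite Ropp_0. field.
  - now apply schwartz_even_part.
  - apply even_part_even.
Qed.

(** Common to both statistics, with s = 1 for Fermi and s = -1 for Bose. For a transform E + O with
    E even and O odd, pairing gives (E + O) kappa + (E - O) (s - kappa) = s E + O (2 kappa - s). The
    first term integrates to the delta contribution; 2 kappa - s is -tanh(beta k / 2) or coth(beta k
    / 2). *)
Lemma fourier_kernel_pv (u v ft kappa : R -> R) (C s : R) :
  0 <= C -> schwartz_R u -> schwartz_R v ->
  (forall k, is_RInt_gen (fun x => u x * cos (k * x) + v x * sin (k * x))
    (Rbar_locally m_infty) (Rbar_locally p_infty) (ft k)) ->
  (forall k, 0 < k -> continuous kappa k) ->
  (forall k, 0 < k -> Rabs (kappa k) <= C * (1 + / k)) ->
  (forall k, 0 < k -> kappa (- k) = s - kappa k) ->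
  admissible (fun k => trig_transform (PI / 2) (odd_part v) k * (2 * kappa k - s)) ->
  is_pv (fun k => ft k * kappa k)
    (s * (PI * u 0) + half_int (fun k => trig_transform (PI / 2) (odd_part v) k * (2 * kappa k - s))).
Proof.
  intros HC Hu Hv Hft Hk Hb Hs Had.
  set (E := trig_transform 0 (even_part u)). set (O := trig_transform (PI / 2) (odd_part v)) in *.
  assert (Hev := schwartz_even_part u Hu). assert (Hod := schwartz_odd_part v Hv).
  assert (FE : fast E) by (apply cos_transform_fast; auto; apply even_part_even).
  assert (FO : fast O) by (apply sin_transform_fast; auto; apply odd_part_odd).
  assert (Eft : ft = fun k => E k + O k).
  { apply functional_extensionality. intros k. now apply line_fourier_int. }
  assert (Eft' : (fun k => ft (- k)) = fun k => E k + - O k).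
  { apply functional_extensionality. intros k. rewrite Eft.
    unfold E, O. rewrite cos_transform_even, sin_transform_odd by now apply schwartz_fast. reflexivity. }
  assert (EQ : forall k, 0 < k ->
     s * E k + O k * (2 * kappa k - s) = ft k * kappa k + ft (- k) * kappa (- k)).
  { intros k Hk0. change (ft (- k)) with ((fun k => ft (- k)) k). rewrite Eft', Eft, Hs by auto. ring. }
  assert (AE : admissible (fun k => s * E k)) by (apply admissible_scal; now apply fast_admissible).
  apply is_pv_kernel_mult with (C + Rabs s).
  - pose proof (Rabs_pos s). lra.
  - rewrite Eft. now apply fast_plus.
  - rewrite Eft'. apply fast_plus; auto. now apply fast_opp.
  - exact Hk.
  - intros k Hk0. apply (continuous_ext_loc _ (fun k => s - kappa k)).
    + exists (mkposreal k Hk0). intros y Hy. symmetry. apply Hs.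
      change (Rabs (y - k) < k) in Hy. apply Rabs_def2 in Hy. lra.
    + apply (continuous_minus (fun _ => s) kappa); auto. apply continuous_const.
  - intros k Hk0. eapply Rle_trans; [now apply Hb|].
    pose proof (Rinv_0_lt_compat k Hk0). pose proof (Rabs_pos s). nra.
  - intros k Hk0. rewrite Hs by auto. eapply Rle_trans; [apply Rabs_triang|]. rewrite Rabs_Ropp.
    pose proof (Hb k Hk0). pose proof (Rinv_0_lt_compat k Hk0). pose proof (Rabs_pos s). nra.
  - apply (admissible_ext _ _ EQ). now apply admissible_plus.
  - rewrite <- (half_int_ext _ _ EQ) by now apply admissible_plus.
    rewrite half_int_plus, half_int_scal by auto using fast_admissible.
    unfold E. now rewrite half_int_cos_even_part.
Qed.

(** * The four principal values *)

Lemma fermi_fourier_pv (beta : R) (u v ft : R -> R) :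
  0 < beta -> schwartz_R u -> schwartz_R v ->
  (forall k, is_RInt_gen (fun x => u x * cos (k * x) + v x * sin (k * x))
    (Rbar_locally m_infty) (Rbar_locally p_infty) (ft k)) ->
  is_pv (fun k => ft k * / (exp (beta * k) + 1))
    (PI * u 0 - half_int (fun x => odd_part v x * csch_kernel beta x)).
Proof.
  intros Hb Hu Hv Hft.
  destruct (tanh_duality (odd_part v) beta Hb) as [A1 [A2 E]];
    [now apply schwartz_odd_part|apply odd_part_odd|].
  assert (EQ : forall k, 0 < k ->
    (-1) * (trig_transform (PI / 2) (odd_part v) k * (1 - 2 / (exp (beta * k) + 1)))
    = trig_transform (PI / 2) (odd_part v) k * (2 * / (exp (beta * k) + 1) - 1)).
  { intros; unfold Rdiv; ring. }
  replace (PI * u 0 - half_int (fun x => odd_part v x * csch_kernel beta x))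
    with (1 * (PI * u 0) + half_int (fun k => trig_transform (PI / 2) (odd_part v) k *
            (2 * / (exp (beta * k) + 1) - 1))).
  - apply (fourier_kernel_pv u v ft (fun k => / (exp (beta * k) + 1)) 1 1); auto.
    + lra.
    + intros k _. pose proof (exp_pos (beta * k)).
      apply @ex_derive_continuous. auto_derive. lra.
    + intros k Hk. pose proof (exp_pos (beta * k)). pose proof (Rinv_0_lt_compat k Hk).
      rewrite Rabs_pos_eq by (apply Rlt_le, Rinv_0_lt_compat; lra).
      apply Rle_trans with (/ 1); [apply Rinv_le_contravar; lra|lra].
    + intros k Hk. replace (beta * - k) with (- (beta * k)) by ring. rewrite exp_Ropp.
      pose proof (exp_pos (beta * k)). field. lra.
    + apply (admissible_ext _ _ EQ). now apply admissible_scal.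
  - rewrite <- (half_int_ext _ _ EQ) by now apply admissible_scal.
    rewrite half_int_scal, E by auto. ring.
Qed.

Lemma bose_fourier_pv (beta : R) (u v ft : R -> R) :
  0 < beta -> schwartz_R u -> schwartz_R v ->
  (forall k, is_RInt_gen (fun x => u x * cos (k * x) + v x * sin (k * x))
    (Rbar_locally m_infty) (Rbar_locally p_infty) (ft k)) ->
  is_pv (fun k => ft k * / (exp (beta * k) - 1))
    (- PI * u 0 + half_int (fun x => odd_part v x * coth_kernel beta x)).
Proof.
  intros Hb Hu Hv Hft.
  destruct (coth_duality (odd_part v) beta Hb) as [A1 [A2 E]];
    [now apply schwartz_odd_part|apply odd_part_odd|].
  assert (EQ : forall k, 0 < k ->
    trig_transform (PI / 2) (odd_part v) k * (1 + 2 / (exp (beta * k) - 1))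
    = trig_transform (PI / 2) (odd_part v) k * (2 * / (exp (beta * k) - 1) - -1)).
  { intros; unfold Rdiv; ring. }
  pose proof (Rinv_0_lt_compat beta Hb) as Hib.
  replace (- PI * u 0 + half_int (fun x => odd_part v x * coth_kernel beta x))
    with (-1 * (PI * u 0) + half_int (fun k => trig_transform (PI / 2) (odd_part v) k *
            (2 * / (exp (beta * k) - 1) - -1))).
  - apply (fourier_kernel_pv u v ft (fun k => / (exp (beta * k) - 1)) (/ beta) (-1)); auto.
    + lra.
    + intros k Hk. pose proof (exp_minus_one_ge (beta * k) ltac:(nra)). assert (0 < beta * k) by nra.
      apply @ex_derive_continuous. auto_derive. lra.
    + intros k Hk. pose proof (bose_bound beta k Hb Hk). pose proof (Rinv_0_lt_compat k Hk).
      rewrite Rabs_pos_eq by lra. nra.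
    + intros k Hk. replace (beta * - k) with (- (beta * k)) by ring. rewrite exp_Ropp.
      pose proof (exp_minus_one_ge (beta * k) ltac:(nra)). assert (0 < beta * k) by nra.
      pose proof (exp_pos (beta * k)). field. split; lra.
    + apply (admissible_ext _ _ EQ). exact A1.
  - rewrite <- (half_int_ext _ _ EQ A1), E. ring.
Qed.

Lemma sinh_opp (x : R) : sinh (- x) = - sinh x.
Proof. unfold sinh. rewrite Ropp_involutive. field. Qed.

Lemma cosh_opp (x : R) : cosh (- x) = cosh x.
Proof. unfold cosh. rewrite Ropp_involutive. field. Qed.

Lemma csch_kernel_odd (beta x : R) : csch_kernel beta (- x) = - csch_kernel beta x.
Proof.
  unfold csch_kernel. replace (PI * - x / beta) with (- (PI * x / beta)) by (unfold Rdiv; ring).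
  rewrite sinh_opp. unfold Rdiv. rewrite Ropp_mult_distr_r_reverse, Rinv_opp. ring.
Qed.

Lemma coth_kernel_odd (beta x : R) : coth_kernel beta (- x) = - coth_kernel beta x.
Proof.
  unfold coth_kernel. replace (PI * - x / beta) with (- (PI * x / beta)) by (unfold Rdiv; ring).
  rewrite sinh_opp, cosh_opp. unfold Rdiv. rewrite Rinv_opp. ring.
Qed.

(** The factor s stands for the sign that multiplication by i or -i puts on the real or imaginary
    part. *)
Lemma csch_pv (beta s : R) (v : R -> R) : 0 < beta -> schwartz_R v ->
  is_pv (fun x => v x * (s * csch_kernel beta x))
    (s * half_int (fun x => odd_part v x * csch_kernel beta x)).
Proof.
  intros Hb Hv.
  destruct (tanh_duality (odd_part v) beta Hb) as [_ [A _]];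
    [now apply schwartz_odd_part|apply odd_part_odd|].
  rewrite <- half_int_scal by auto.
  rewrite (half_int_ext _ (fun x => odd_part v x * (s * csch_kernel beta x)))
    by (auto using admissible_scal; intros; ring).
  apply is_pv_odd_kernel with (Rabs s); auto using Rabs_pos.
  - intros x. rewrite csch_kernel_odd. ring.
  - intros x Hx. apply (continuous_scal_r s (csch_kernel beta)).
    exact (proj2 (continuous_kernels beta x Hb Hx)).
  - intros x Hx. pose proof (csch_kernel_bound beta x Hb Hx).
    rewrite Rabs_mult, (Rabs_pos_eq (csch_kernel _ _)) by lra.
    apply Rmult_le_compat_l; [apply Rabs_pos|lra].
Qed.

Lemma coth_pv (beta s : R) (v : R -> R) : 0 < beta -> schwartz_R v ->
  is_pv (fun x => v x * (s * coth_kernel beta x))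
    (s * half_int (fun x => odd_part v x * coth_kernel beta x)).
Proof.
  intros Hb Hv.
  destruct (coth_duality (odd_part v) beta Hb) as [_ [A _]];
    [now apply schwartz_odd_part|apply odd_part_odd|].
  rewrite <- half_int_scal by auto.
  rewrite (half_int_ext _ (fun x => odd_part v x * (s * coth_kernel beta x)))
    by (auto using admissible_scal; intros; ring).
  assert (0 < PI / beta) by (apply Rdiv_lt_0_compat; auto; apply PI_RGT_0).
  pose proof (Rabs_pos s).
  apply is_pv_odd_kernel with (Rabs s * (1 + PI / beta)); auto.
  - apply Rmult_le_pos; lra.
  - intros x. rewrite coth_kernel_odd. ring.
  - intros x Hx. apply (continuous_scal_r s (coth_kernel beta)).
    exact (proj1 (continuous_kernels beta x Hb Hx)).
  - intros x Hx. rewrite Rabs_mult, Rmult_assoc.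
    apply Rmult_le_compat_l; [apply Rabs_pos|now apply coth_kernel_bound].
Qed.

(** * From real and imaginary parts to the complex statement *)

Lemma odd_part_opp_half_int (v kappa : R -> R) :
  admissible (fun x => odd_part v x * kappa x) ->
  half_int (fun x => odd_part (fun x => - v x) x * kappa x) =
  - half_int (fun x => odd_part v x * kappa x).
Proof.
  intros A. replace (- half_int (fun x => odd_part v x * kappa x))
    with ((-1) * half_int (fun x => odd_part v x * kappa x)) by ring.
  rewrite <- half_int_scal by auto. symmetry.
  apply half_int_ext; [|now apply admissible_scal]. intros x _. unfold odd_part. ring.
Qed.

(** The imaginary part of (u + i v) e^(- i k x) has the shape of the real part with (u, v) replaced
    by (v, - u), so the real lemmas serve for both. *)
Lemma fourier_Re_Im (phi phihat : R -> C) (k : R) :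
  is_fourier phi phihat ->
  is_RInt_gen (fun x => Re (phi x) * cos (k * x) + Im (phi x) * sin (k * x))
    (Rbar_locally m_infty) (Rbar_locally p_infty) (Re (phihat k)) /\
  is_RInt_gen (fun x => Im (phi x) * cos (k * x) + - Re (phi x) * sin (k * x))
    (Rbar_locally m_infty) (Rbar_locally p_infty) (Im (phihat k)).
Proof.
  intros H. destruct (is_RInt_gen_Re_Im _ _ _ _ (H k)) as [H1 H2].
  split; (eapply is_RInt_gen_ext; [|eassumption]); apply filter_forall; intros ab x _;
    unfold cis; rewrite cos_neg, sin_neg; destruct (phi x); simpl; ring.
Qed.

Theorem theorem3p6 (beta : R) (Hbeta : 0 < beta)
  (phi phihat : R -> C) (Hphi : schwartz phi) (Hhat : is_fourier phi phihat) :
  (exists cg : C,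
     fp_int (fun x => Cmult (g_fun beta x) (phi x)) cg /\
     fp_int (fun x => Cmult (phihat x) (f_plus beta x))
       (Cplus (Cmult (RtoC PI) (phi 0)) cg)) /\
  (exists ch : C,
     fp_int (fun x => Cmult (h_fun beta x) (phi x)) ch /\
     fp_int (fun x => Cmult (phihat x) (f_minus beta x))
       (Cplus (Cmult (RtoC (- PI)) (phi 0)) ch)).
Proof.
  destruct Hphi as [Hu Hv].
  set (u := fun x => Re (phi x)) in *. set (v := fun x => Im (phi x)) in *.
  assert (Hu' := schwartz_opp u Hu).
  assert (H1 : forall k, is_RInt_gen (fun x => u x * cos (k * x) + v x * sin (k * x))
    (Rbar_locally m_infty) (Rbar_locally p_infty) (Re (phihat k)))
    by exact (fun k => proj1 (fourier_Re_Im phi phihat k Hhat)).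
  assert (H2 : forall k, is_RInt_gen (fun x => v x * cos (k * x) + - u x * sin (k * x))
    (Rbar_locally m_infty) (Rbar_locally p_infty) (Im (phihat k)))
    by exact (fun k => proj2 (fourier_Re_Im phi phihat k Hhat)).
  assert (Ou := schwartz_odd_part u Hu).
  split.
  (* Multiplying by i sends u + i v to - v + i u, which gives the two components. *)
  - exists (-1 * half_int (fun x => odd_part v x * csch_kernel beta x),
            1 * half_int (fun x => odd_part u x * csch_kernel beta x)). split.
    + apply (fp_int_of_pv _ (fun x => v x * (-1 * csch_kernel beta x))
        (fun x => u x * (1 * csch_kernel beta x))); auto using csch_pv.
      intros x. unfold g_fun, u, v, csch_kernel, Cmult. destruct (phi x); simpl. f_equal; ring.
    + destruct (tanh_duality (odd_part u) beta Hbeta Ou (odd_part_odd u)) as [_ [A _]].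
      pose proof (fermi_fourier_pv beta u v _ Hbeta Hu Hv H1) as P1.
      pose proof (fermi_fourier_pv beta v (fun x => - u x) _ Hbeta Hv Hu' H2) as P2.
      rewrite (odd_part_opp_half_int u _ A) in P2.
      match goal with |- fp_int _ ?c => replace c with
        (PI * u 0 - half_int (fun x => odd_part v x * csch_kernel beta x),
         PI * v 0 - - half_int (fun x => odd_part u x * csch_kernel beta x)) end.
      * eapply fp_int_of_pv; [|exact P1|exact P2].
        intros x. unfold f_plus, RtoC, Cmult. destruct (phihat x); simpl. f_equal; ring.
      * unfold u, v, Cplus, Cmult, RtoC. destruct (phi 0); simpl. f_equal; ring.
  (* Here the factor is -i, and -i (u + i v) = v - i u. *)
  - exists (1 * half_int (fun x => odd_part v x * coth_kernel beta x),
            -1 * half_int (fun x => odd_part u x * coth_kernel beta x)). split.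
    + apply (fp_int_of_pv _ (fun x => v x * (1 * coth_kernel beta x))
        (fun x => u x * (-1 * coth_kernel beta x))); auto using coth_pv.
      intros x. unfold h_fun, u, v, coth_kernel, Cmult. destruct (phi x); simpl. f_equal; ring.
    + destruct (coth_duality (odd_part u) beta Hbeta Ou (odd_part_odd u)) as [_ [A _]].
      pose proof (bose_fourier_pv beta u v _ Hbeta Hu Hv H1) as P1.
      pose proof (bose_fourier_pv beta v (fun x => - u x) _ Hbeta Hv Hu' H2) as P2.
      rewrite (odd_part_opp_half_int u _ A) in P2.
      match goal with |- fp_int _ ?c => replace c with
        (- PI * u 0 + half_int (fun x => odd_part v x * coth_kernel beta x),
         - PI * v 0 + - half_int (fun x => odd_part u x * coth_kernel beta x)) end.
      * eapply fp_int_of_pv; [|exact P1|exact P2].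
        intros x. unfold f_minus, RtoC, Cmult. destruct (phihat x); simpl. f_equal; ring.
      * unfold u, v, Cplus, Cmult, RtoC. destruct (phi 0); simpl. f_equal; ring.
Qed.
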